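(* Let $n\in\mathbb{N}$ and $1<p\le2$. There is a constant $C=C(n,p)<\infty$ such that for every real-valued $f\in L^p(\mathbb{H}^n)$ with distributional horizontal gradient $\nabla_{\mathbb{H}}f\in L^p(\mathbb{H}^n)$, $$\left(\int_0^\infty\left[\int_{\mathbb{H}^n}\left(\frac{|f(x)-f(x\cdot(\mathbf{0},t))|}{\sqrt t}\right)^p dx\right]^{2/p}\frac{dt}{t}\right)^{1/2}\le C\,\|\nabla_{\mathbb{H}}f\|_{L^p(\mathbb{H}^n)},$$ where $(\mathbf{0},t)$ denotes the point $(0,\dots,0,t)\in\mathbb{R}^{2n}\times\mathbb{R}$.
   Context: Heisenberg group: $\mathbb{H}^n=(\mathbb{R}^{2n+1},\cdot)$, points $x=(z,t)\in\mathbb{R}^{2n}\times\mathbb{R}$, with group law $(z,t)\cdot(z',t')=\bigl(z+z',\,t+t'+\tfrac12\sum_{j=1}^n(z_jz'_{n+j}-z_{n+j}z'_j)\bigr)$. The vector fields $X_1,\dots,X_{2n}$ are the left-invariant ones such that $X_j(0)$ is the $j$-th standard basis vector, i.e. $X_j=\partial_{z_j}-\tfrac12z_{n+j}\partial_t$ and $X_{n+j}=\partial_{z_{n+j}}+\tfrac12z_j\partial_t$ for $1\le j\le n$. When the distributional derivatives exist, $\nabla_{\mathbb{H}}f=(X_1f,\dots,X_{2n}f)$. Integration is with respect to Lebesgue measure on $\mathbb{R}^{2n+1}$. *)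

(* Defs.v *)
From HB Require Import structures.
From mathcomp Require Import all_boot all_order all_algebra.
From mathcomp Require Import all_classical all_reals all_analysis.

Set Implicit Arguments.
Unset Strict Implicit.
Unset Printing Implicit Defensive.

Import Order.TTheory GRing.Theory Num.Theory.
Import numFieldNormedType.Exports.

Local Open Scope classical_set_scope.
Local Open Scope ring_scope.

Definition rV_display : measure_display. Proof. exact. Qed.

(* The Borel (product) sigma-algebra of R^m, generated by the coordinates;
   this mirrors the library's sigma-algebra on [m.-tuple R]. *)
Section measurable_rV.
Context (R : realType) (m : nat).

Definition rV_coor (i : 'I_m) (x : 'rV[R]_m) : measurableTypeR R := x ord0 i.

Let rV_set0 : g_sigma_preimage rV_coor set0.
Proof. exact: sigma_algebra0. Qed.

Let rV_setC A : g_sigma_preimage rV_coor A -> g_sigma_preimage rV_coor (~` A).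
Proof. exact: sigma_algebraC. Qed.

Let rV_bigcup (F : _^nat) : (forall i, g_sigma_preimage rV_coor (F i)) ->
  g_sigma_preimage rV_coor (\bigcup_i (F i)).
Proof. exact: sigma_algebra_bigcup. Qed.

HB.instance Definition _ := @isMeasurable.Build rV_display
  'rV[R]_m (g_sigma_preimage rV_coor) rV_set0 rV_setC rV_bigcup.

End measurable_rV.

Lemma measurable_rV_coor (R : realType) m (i : 'I_m) :
  measurable_fun [set: 'rV[R]_m] (@rV_coor R m i).
Proof.
move=> _ Y mY; rewrite setTI; apply: sub_sigma_algebra => /=.
rewrite -bigcup_seq/=; exists i => /=; first by rewrite mem_index_enum.
by exists Y => //; rewrite setTI.
Qed.

Lemma measurable_fun_rVP d (T : measurableType d) (R : realType) m
    (f : T -> 'rV[R]_m) :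
  measurable_fun [set: T] f <->
  forall i, measurable_fun [set: T] (@rV_coor R m i \o f).
Proof.
split=> [mf i|mf].
  by apply: measurableT_comp => //; exact: measurable_rV_coor.
move=> _ A mA; rewrite setTI.
have : g_sigma_preimage (fun i => @rV_coor R m i \o f) (f @^-1` A).
  by rewrite g_sigma_preimage_comp; exists A => //; rewrite setTI.
apply: smallest_sub; first exact: sigma_algebra_measurable.
rewrite -bigcup_seq; apply: bigcup_sub => i _ B [C mC <-].
exact: mf.
Qed.

Section lebesgue_rV.
Context (R : realType).

Definition rV_cons m (x : measurableTypeR R * 'rV[R]_m) : 'rV[R]_m.+1 :=
  \row_i (if unlift ord0 i is Some j then x.2 ord0 j else x.1).

Definition rV_uncons m (x : 'rV[R]_m.+1) : measurableTypeR R * 'rV[R]_m :=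
  (x ord0 ord0, \row_j x ord0 (lift ord0 j)).

Lemma rV_cons0 m (x : measurableTypeR R * 'rV[R]_m) :
  rV_cons x ord0 ord0 = x.1.
Proof. by rewrite mxE unlift_none. Qed.

Lemma rV_consS m (x : measurableTypeR R * 'rV[R]_m) j :
  rV_cons x ord0 (lift ord0 j) = x.2 ord0 j.
Proof. by rewrite mxE liftK. Qed.

Lemma rV_consK m : cancel (@rV_cons m) (@rV_uncons m).
Proof.
move=> x; rewrite /rV_uncons rV_cons0 [RHS]surjective_pairing; congr pair.
by apply/rowP => j; rewrite mxE rV_consS.
Qed.

Lemma measurable_rV_cons m : measurable_fun [set: _] (@rV_cons m).
Proof.
apply/measurable_fun_rVP => i.
have [->|[j ->]] : i = ord0 \/ exists j, i = lift ord0 j.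
  by case: (unliftP ord0 i) => [j ->|->]; [right; exists j|left].
  rewrite (_ : _ \o _ = fst)//.
  by apply/funext => x; rewrite /= /rV_coor rV_cons0.
rewrite (_ : _ \o _ = @rV_coor R m j \o snd).
  by apply: measurableT_comp => //; exact: measurable_rV_coor.
by apply/funext => x; rewrite /= /rV_coor rV_consS.
Qed.

Lemma measurable_rV_uncons m : measurable_fun [set: _] (@rV_uncons m).
Proof.
apply: measurable_fun_pair; first exact: (measurable_rV_coor ord0).
apply/measurable_fun_rVP => i.
rewrite (_ : _ \o _ = @rV_coor R m.+1 (lift ord0 i)).
  exact: measurable_rV_coor.
by apply/funext => x; rewrite /= /rV_coor mxE.
Qed.

Section step.
Context (m : nat) (mu : {sigma_finite_measure set 'rV[R]_m -> \bar R}).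

Let lebesgue_rVS_fun : set 'rV[R]_m.+1 -> \bar R :=
  pushforward (@lebesgue_measure R \x mu)%E (@rV_cons m).

Let lebesgue_rVS0 : lebesgue_rVS_fun set0 = 0%E.
Proof. by rewrite /lebesgue_rVS_fun /pushforward preimage_set0 measure0. Qed.

Let lebesgue_rVS_ge0 A : (0 <= lebesgue_rVS_fun A)%E.
Proof. exact: (measure_ge0 (@lebesgue_measure R \x mu)%E). Qed.

Let lebesgue_rVS_sigma_additive : semi_sigma_additive lebesgue_rVS_fun.
Proof.
exact: (@measure_semi_sigma_additive _ _ _
  (measure_function_pushforward__canonical__measure_function_Measure _
    (@measurable_rV_cons m))).
Qed.

HB.instance Definition _ := isMeasure.Build _ _ _
  lebesgue_rVS_fun lebesgue_rVS0 lebesgue_rVS_ge0 lebesgue_rVS_sigma_additive.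

Let lebesgue_rVS_sigma_finite : sigma_finite setT lebesgue_rVS_fun.
Proof.
have /sigma_finiteP[F [TF ndF Foo]] := sigma_finiteT (@lebesgue_measure R).
have /sigma_finiteP[G [TG ndG Goo]] := sigma_finiteT mu.
exists (fun k => @rV_uncons m @^-1` (F k `*` G k)).
  apply/esym; rewrite -subTset => x _.
  have : [set: measurableTypeR R] (rV_uncons x).1 by [].
  have : [set: 'rV[R]_m] (rV_uncons x).2 by [].
  rewrite TF TG => -[k _ Gx] [l _ Fx]; exists (maxn k l) => //; split.
    exact/(subsetPset _ _ (ndF _ _ (leq_maxr k l))).
  exact/(subsetPset _ _ (ndG _ _ (leq_maxl k l))).
move=> k; have [mF Fk] := Foo k; have [mG Gk] := Goo k; split.
  rewrite -[X in measurable X]setTI; apply: measurable_rV_uncons => //.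
  exact: measurableX.
rewrite /lebesgue_rVS_fun /pushforward.
rewrite -comp_preimage (_ : _ \o _ = id); last first.
  by apply/funext; exact: rV_consK.
rewrite preimage_id.
by rewrite product_measure1E// lte_mul_pinfty// ge0_fin_numE.
Qed.

HB.instance Definition _ := Measure_isSigmaFinite.Build _ _ _
  lebesgue_rVS_fun lebesgue_rVS_sigma_finite.

Definition lebesgue_rVS : {sigma_finite_measure set 'rV[R]_m.+1 -> \bar R} :=
  lebesgue_rVS_fun.

End step.

(* Lebesgue measure on R^m, with R^0 a point of mass 1 and R^(m+1) identified
   with R * R^m. *)
Fixpoint lebesgue_rV m : {sigma_finite_measure set 'rV[R]_m -> \bar R} :=
  match m with
  | 0 => \d_(0 : 'rV[R]_0)
  | m'.+1 => lebesgue_rVS (lebesgue_rV m')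
  end.

End lebesgue_rV.

Notation heis R n := ('rV[R]_(n + n) * R)%type.

Section heisenberg.
Context (R : realType) (n : nat).
Implicit Types (x y : heis R n) (f g phi : heis R n -> R) (i : 'I_(n + n)).

(* The paired coordinates z_j, z_(n+j) are indexed by [lshift n j], [rshift n j]. *)
Definition hmul x y : heis R n :=
  (x.1 + y.1,
   x.2 + y.2 + 2^-1 * \sum_(j < n)
     (x.1 ord0 (lshift n j) * y.1 ord0 (rshift n j)
      - x.1 ord0 (rshift n j) * y.1 ord0 (lshift n j))).

(* [measurableTypeR R] is convertible to [R]; the library's [lebesgue_measure]
   lives on the former. *)
Definition lebesgue_heis :
    {measure set ('rV[R]_(n + n) * measurableTypeR R)%type -> \bar R} :=
  (lebesgue_rV R (n + n) \x @lebesgue_measure R)%E.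

Definition partial_z i phi x : R :=
  'D_((delta_mx ord0 i, 0) : heis R n) phi x.

Definition partial_t phi x : R := 'D_((0, 1) : heis R n) phi x.

Definition hX i phi x : R :=
  match fintype.split i with
  | inl j => partial_z i phi x - 2^-1 * x.1 ord0 (rshift n j) * partial_t phi x
  | inr j => partial_z i phi x + 2^-1 * x.1 ord0 (lshift n j) * partial_t phi x
  end.

(* C^oo: all iterated directional derivatives exist and are continuous. *)
Definition smooth phi : Prop :=
  forall s : seq (heis R n),
    let psi := foldr (fun v h => 'D_v h) phi s in
    continuous psi /\ forall x v, derivable psi x v.

Definition test_function phi : Prop :=
  smooth phi /\ compact (closure [set x | phi x != 0]).

(* [X_i f = g] as distributions; the coefficient of d/dt in X_i does not depend
   on t and that of d/dz_i is constant, so that the formal adjoint of X_i is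
   - X_i. The integrals are meaningful for locally integrable f and g. *)
Definition is_weak_hX i f g : Prop :=
  forall phi, test_function phi ->
    \int[lebesgue_heis]_x (f x * hX i phi x)
    = - \int[lebesgue_heis]_x (g x * phi x).

(* [G i] is the i-th component of the distributional horizontal gradient. *)
Definition is_weak_hgrad f (G : 'I_(n + n) -> heis R n -> R) : Prop :=
  forall i, is_weak_hX i f (G i).

Definition hnorm (G : 'I_(n + n) -> heis R n -> R) x : R :=
  Num.sqrt (\sum_i G i x ^+ 2).

End heisenberg.

(* Main.v *)
From HB Require Import structures.
From mathcomp Require Import all_boot all_order all_algebra.
From mathcomp Require Import all_classical all_reals all_analysis measurable_realfun.
From mathcomp Require Import ring lra.
Require Import Defs.

Import Order.TTheory GRing.Theory Num.Theory.
Import numFieldNormedType.Exports.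

Local Open Scope classical_set_scope.
Local Open Scope ring_scope.

(** Write [T_s] for right translation by the central point [(0, s)], [D_s] for
[T_s - 1] and [N] for the norm of [L^p]. Three facts carry the proof.

- Translating along [exp (r X_i)] moves a function [f] by at most [r N (X_i f)]
  (lemma [horizontal_estimate]). As [(0, r^2)] is the commutator of
  [exp (r X_j)] and [exp (r X_(n+j))], four such moves give
  [N (D_s f) <= 2 sqrt s (N (X_j f) + N (X_(n+j) f))]
  (lemma [vertical_sqrt_estimate]).
- The [T_s] come from the centre: a linear combination of them turns a weak
  derivative [g] of [f] into the same combination of [g]
  (lemmas [htest_weak_lin], [htest_weak_vshift]), and they preserve [N].
- For [1 < p <= 2] the norm [N] is 2-uniformly convex
  (lemma [Lp_uniform_convexity]).

The first fact only bounds [N (D_t f) / sqrt t]. That this quantity is square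
integrable for [dt / t] comes from a Littlewood-Paley argument in the central
variable (section [dyadic]) in which uniform convexity replaces square
functions. Fix [sigma > 0], let [s_i = 2^i sigma], [E_0 = 1] and
[E_(i+1) = (1 + T_(s_i)) E_i / 2], an average over an arithmetic progression of
step [sigma]. The function [E_(i+1) g] is the midpoint of [E_i g] and of its
translate, which have the same norm, so that
[N (E_(i+1) g)^2 + c N (D_(s_i) E_i g)^2 <= N (E_i g)^2]; these inequalities
telescope to [c sum_i N (D_(s_i) E_i g)^2 <= N (g)^2]. On the other hand,
writing [D_i] for [D_(s_i)],
[D_i E_i = D_(i+1) E_(i+1) / 2 - D_(i+1) D_i E_i / 4 - D_i D_i E_i / 2],
and the square root estimate, applied to [D_i E_i f], bounds the last two terms
by [sqrt s_i] times [N (D_i E_i g)] summed over two components [g] of the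
gradient. After division by [sqrt s_i] this recursion contracts by
[1 / sqrt 2], which yields [sum_i N (D_i E_i f)^2 / s_i <= C N (grad f)^2].
Two more recursions with the same contraction ratio recover [D_i f] from the
[D_i E_i f], and [D_t f], for every [t <= s_m], from the [D_i f] with [i < m]
by the binary expansion of [t]. This bounds the integral over
[(sigma, +oo)] uniformly in [sigma].

The estimate along [exp (r X_i)] for weak derivatives is obtained by testing:
for every test function [phi], the integral of [(f (x exp (r X_i)) - f x) phi x]
is that of [k phi], where [k x] is the integral of [g] along the flow line from
[x] to [x exp (r X_i)], by the fundamental theorem of calculus for [phi], the
definition of [g] and Fubini (lemma [htest_weak_integral]). Since test functions
separate [L^p] (lemma [Lp_norm_eq0_htest]), the two factors agree almost
everywhere, and Hoelder's inequality bounds the norm of [k]. *)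

(** * A two-point inequality for powers *)

Section two_point.
Context {R : realType}.
Implicit Types (a b t x y p : R).

(** Young's inequality with one factor equal to [1]. *)
Lemma powR_le_tangent y a : 0 <= y -> 0 < a <= 1 ->
  y `^ a <= 1 + a * (y - 1).
Proof.
move=> y0 /andP[a0]; rewrite le_eqVlt => /predU1P[->|a1].
  by rewrite powRr1// mul1r subrKC.
have := @conjugate_powR _ (y `^ a) 1 a^-1 (1 - a)^-1 (powR_ge0 _ _) ler01.
rewrite !invr_gt0 subr_gt0 !invrK subrKC mulr1 powR1 mul1r => /(_ a0 a1 erefl).
rewrite -powRrM mulfV ?gt_eqF// powRr1//; lra.
Qed.

(** The defect of midpoint convexity of [x |-> |x|^p]. *)
Definition midpoint_gap p a b : R :=
  (`|a| `^ p + `|b| `^ p) / 2 - `|(a + b) / 2| `^ p.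

(** By homogeneity the larger of the two numbers can be taken to be [1]. For
[0 <= x], with [u = (1 + x) / 2] and [q = p - 1], the gap is
[((1 - u^q) - x (u^q - x^q)) / 2], and the concavity of [y |-> y^q] bounds both
terms from below by tangents. For [x < 0] the gap is already at least
[1 / 2 - 2^(- p)]. *)
Lemma midpoint_gap_ge1 p x : 1 < p <= 2 -> -1 <= x <= 1 ->
  (p - 1) ^+ 2 / 16 * (1 - x) ^+ 2 <= midpoint_gap p 1 x.
Proof.
move=> /andP[p1 p2] /andP[xN1 x1].
rewrite /midpoint_gap normr1 powR1.
have p0 : 0 < p by lra.
have th : 0 < p - 1 <= 1 by lra.
have [x0|x0] := leP 0 x.
  pose u := (1 + x) / 2; have u0 : 0 <= u by rewrite divr_ge0// addr_ge0.
  rewrite -/u !ger0_norm// -(mulr_powRB1 x0)// -(mulr_powRB1 u0)//.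
  have := powR_le_tangent _ _ u0 th.
  have := powR_le_tangent _ _ x0 th.
  have : x * u `^ (p - 1) <= x `^ (p - 1) * (x + (p - 1) * (u - x)).
    move: x0; rewrite le_eqVlt => /predU1P[<-|x0].
      by rewrite mul0r powR0 ?mul0r// gt_eqF//; lra.
    have ux0 : 0 <= u / x by rewrite divr_ge0// ltW.
    rewrite -[in leLHS](divfK (lt0r_neq0 x0) u) powRM ?(ltW x0)//.
    have := powR_le_tangent _ _ ux0 th.
    rewrite -(ler_pM2l (mulr_gt0 x0 (powR_gt0 (p - 1) x0))).
    by rewrite (_ : x * x `^ (p - 1) * (1 + _) = x `^ (p - 1) * (x + (p - 1) * (u - x)));
      [rewrite mulrAC -mulrA|field; exact: lt0r_neq0].
  set v := x `^ _; set w := u `^ _; set q := p - 1 in th *.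
  move=> h1 h2 h3; have /andP[q0 q1] := th.
  have : 0 <= q * (1 - x) * (1 - v - q * (1 - x)).
    by rewrite !mulr_ge0//; lra.
  have : 0 <= (q * (1 - x)) ^+ 2 by exact: sqr_ge0.
  rewrite /u in h1 h3 *; lra.
have y0 : 0 <= - x by lra.
rewrite ltr0_norm// [`|(1 + x) / 2|]ger0_norm; last by lra.
have h2 := powR_le_tangent 2^-1 (p - 1) (ltac:(by lra)) th.
have : ((1 + x) / 2) `^ p <= (1 + x) * (2^-1 `^ p).
  rewrite powRM; [|by lra..]; rewrite ler_wpM2r ?powR_ge0//.
  have : 0 <= 1 + x by lra.
  rewrite le_eqVlt => /predU1P[<-|x10]; first by rewrite powR0// gt_eqF.
  by apply: ge1r_powR; lra.
rewrite -[2^-1 `^ p]mulr_powRB1//.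
have := powR_ge0 (- x) p.
have := powR_ge0 2^-1 (p - 1).
set v := 2^-1 `^ _ in h2 *; set w := (- x) `^ _; set z := _ `^ p; set q := p - 1 in th h2 *.
move=> v0 w0 h1.
have /andP[q0 q1] := th.
have : (1 + x) * v <= v by rewrite -[leRHS]mul1r ler_wpM2r//; lra.
have : q ^+ 2 * (1 - x) ^+ 2 <= q * 4.
  apply: ler_pM; rewrite ?sqr_ge0//.
    by rewrite expr2 -[leRHS]mulr1 ler_wpM2l// ltW.
  have := sqr_ge0 (1 + x); have : 0 <= (1 - x) * (1 + x) by rewrite mulr_ge0; lra.
  lra.
lra.
Qed.

Lemma midpoint_gap_scale p a b c : midpoint_gap p (c * a) (c * b)
  = `|c| `^ p * midpoint_gap p a b.
Proof.
by rewrite /midpoint_gap -mulrDr -mulrA !(normrM c) !powRM//; ring.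
Qed.

Lemma midpoint_gapC p a b : midpoint_gap p a b = midpoint_gap p b a.
Proof. by rewrite /midpoint_gap [`|b| `^ p + _]addrC [b + a]addrC. Qed.

Lemma midpoint_gap_ge0 p a b : 1 < p <= 2 -> 0 <= midpoint_gap p a b.
Proof.
move=> hp; wlog ab : a b / `|b| <= `|a|.
  by move=> H; have [/H//|/ltW/H] := leP `|b| `|a|; rewrite midpoint_gapC.
have [a0|a0] := eqVneq a 0.
  move: ab; rewrite a0 normr0 normr_le0 => /eqP ->.
  by rewrite /midpoint_gap addr0 mul0r normr0 !powR0 ?addr0 ?mul0r ?subr0// gt_eqF//; lra.
rewrite -[a in midpoint_gap p a _]mulr1 -(divfK a0 b) [b / a * a]mulrC midpoint_gap_scale.
rewrite mulr_ge0 ?powR_ge0//; apply: le_trans (midpoint_gap_ge1 _ _ hp _).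
  by rewrite mulr_ge0 ?divr_ge0 ?sqr_ge0.
by rewrite -ler_norml normrM normfV ler_pdivrMr ?normr_gt0// mul1r.
Qed.

(** The form of 2-convexity that integrates without Hoelder's inequality: [t] is
free, and is chosen after integration. If [|a - b|] is at most [t] times the
larger of [|a|] and [|b|], the first term on the right is enough; otherwise
[|a - b|^p] is controlled by [|a - b|^2]. *)
Lemma powR_dist_le_gap p a b t : 1 < p <= 2 -> 0 < t ->
  t `^ (2 - p) * `|a - b| `^ p <=
  t ^+ 2 * (`|a| `^ p + `|b| `^ p) + 16 / (p - 1) ^+ 2 * midpoint_gap p a b.
Proof.
move=> hp t0; have /andP[p1 p2] := hp.
have k0 : 0 < 16 / (p - 1) ^+ 2 by rewrite divr_gt0// exprn_gt0//; lra.
wlog ab : a b / `|b| <= `|a|.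
  move=> H; have [/H//|/ltW/H] := leP `|b| `|a|.
  by rewrite midpoint_gapC distrC [_ + `|a| `^ _]addrC.
have [a0|a0] := eqVneq a 0.
  move: ab; rewrite a0 normr0 normr_le0 => /eqP ->.
  rewrite subrr normr0 powR0 ?gt_eqF//; last lra.
  by rewrite mulr0 addr0 mulr0 add0r mulr_ge0 ?midpoint_gap_ge0// ltW.
rewrite -(divfK a0 b) [b / a * a]mulrC.
have x1 : -1 <= b / a <= 1.
  by rewrite -ler_norml normrM normfV ler_pdivrMr ?normr_gt0// mul1r.
move: (b / a) x1 => x x1; rewrite -{1 3 5}[a]mulr1 midpoint_gap_scale -mulrBr.
rewrite !(normrM a) !powRM// normr1 powR1 mulr1.
have := midpoint_gap_ge1 _ _ hp x1.
set G := midpoint_gap _ _ _; set A := `|a| `^ p.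
have A0 : 0 <= A by exact: powR_ge0.
rewrite -[(p - 1) ^+ 2 / 16]invf_div ler_pdivrMl//.
move: k0; set k := 16 / _ => k0 hG.
rewrite (_ : t `^ (2 - p) * _ = A * (t `^ (2 - p) * `|1 - x| `^ p)); last by ring.
rewrite (_ : _ + _ = A * (t ^+ 2 * (1 + `|x| `^ p) + k * G)); last by ring.
rewrite ler_wpM2l//.
have X0 := powR_ge0 `|x| p.
have t20 : 0 <= t ^+ 2 by exact: sqr_ge0.
have sq y : 0 < y -> y `^ (2 - p) * y `^ p = y ^+ 2.
  move=> y0; rewrite -powRD; first by rewrite subrK powR_mulrn// ltW.
  by rewrite (gt_eqF y0) implybT.
have p0 : 0 <= p by lra.
have q0 : 0 <= 2 - p by lra.
have [xt|tx] := leP `|1 - x| t.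
  apply: (@le_trans _ _ (t ^+ 2)).
    rewrite -[leRHS]sq// ler_wpM2l ?powR_ge0//.
    by apply: ge0_ler_powR; rewrite ?nnegrE// ltW.
  have : 0 <= t ^+ 2 * `|x| `^ p by rewrite mulr_ge0.
  have := midpoint_gap_ge0 _ 1 x hp; rewrite -/G => /(mulr_ge0 (ltW k0)).
  lra.
apply: (@le_trans _ _ ((1 - x) ^+ 2)); last first.
  have : 0 <= t ^+ 2 * `|x| `^ p by rewrite mulr_ge0.
  lra.
rewrite -[leRHS]real_normK ?num_real// -[leRHS]sq; last exact: lt_trans tx.
rewrite ler_wpM2r ?powR_ge0//.
by apply: ge0_ler_powR; rewrite ?nnegrE// ltW.
Qed.

End two_point.

(** * Dyadic decomposition of a one-parameter group of isometries *)

Section numeric.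
Context {R : realType}.
Implicit Types (s : R) (x y : R^nat).

Lemma geometric_scale_gt0 s i : 0 < s -> 0 < 2 ^+ i * s.
Proof. by move=> s0; rewrite mulr_gt0// exprn_gt0. Qed.

(** The boundary term [x M] is the price for running the recursion from fine
to coarse scales; it is made small by letting [M] grow. *)
Lemma sum_backward_recursion x y M :
  (forall i, 0 <= x i) -> (forall i, x i <= 3/4 * x i.+1 + y i) ->
  \sum_(i < M) x i <= 3 * x M + 4 * \sum_(i < M) y i.
Proof.
move=> x0 xy.
have : \sum_(i < M) x i <= 3/4 * \sum_(i < M) x i.+1 + \sum_(i < M) y i.
  by rewrite mulr_sumr -big_split/=; apply: ler_sum.
have : \sum_(i < M) x i.+1 + x 0%N = \sum_(i < M) x i + x M.
  by elim: M => [|M IH]; rewrite ?big_ord0 ?add0r// !big_ord_recr/=; lra.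
have := x0 0%N; lra.
Qed.

Lemma sum_forward_recursion s x y M : 0 < s ->
  (forall i, x i.+1 = x i + y i) ->
  \sum_(i < M.+1) x i ^+ 2 / (2 ^+ i * s)
    <= 4 * (x 0%N ^+ 2 / s) + 6 * \sum_(i < M) y i ^+ 2 / (2 ^+ i * s).
Proof.
move=> s0 xy.
have step i : x i.+1 ^+ 2 / (2 ^+ i.+1 * s)
    <= 3/4 * (x i ^+ 2 / (2 ^+ i * s)) + 3/2 * (y i ^+ 2 / (2 ^+ i * s)).
  have := geometric_scale_gt0 s i s0; set u := 2 ^+ i * s => u0.
  rewrite [2 ^+ _.+1]exprS -mulrA -/u xy -subr_ge0.
  rewrite (_ : _ - _ = 4^-1 * (x i - 2 * y i) ^+ 2 / u); last first.
    by field; exact: lt0r_neq0.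
  by apply: divr_ge0; [rewrite pmulr_rge0 ?sqr_ge0|exact: ltW].
have : \sum_(i < M) x i.+1 ^+ 2 / (2 ^+ i.+1 * s) <=
   3/4 * \sum_(i < M) x i ^+ 2 / (2 ^+ i * s)
   + 3/2 * \sum_(i < M) y i ^+ 2 / (2 ^+ i * s).
  by rewrite 2!mulr_sumr -big_split/=; apply: ler_sum.
have : \sum_(i < M) x i ^+ 2 / (2 ^+ i * s)
    <= \sum_(i < M.+1) x i ^+ 2 / (2 ^+ i * s).
  rewrite big_ord_recr/= lerDl; apply: divr_ge0; first exact: sqr_ge0.
  exact/ltW/geometric_scale_gt0.
have : \sum_(i < M.+1) x i ^+ 2 / (2 ^+ i * s) =
  x 0%N ^+ 2 / s + \sum_(i < M) x i.+1 ^+ 2 / (2 ^+ i.+1 * s).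
  by rewrite big_ord_recl/= expr0 mul1r.
lra.
Qed.

(** The weights come from [(z / 2 + y)^2 <= 3/8 z^2 + 3 y^2]; the
factor [2] between consecutive scales turns [3/8] into [3/4], still below [1]. *)
Lemma halving_sq_le (x y z s : R) : 0 < s -> 0 <= x -> 0 <= z ->
  x <= z / 2 + Num.sqrt s * y ->
  x ^+ 2 / s <= 3/4 * (z ^+ 2 / (2 * s)) + 3 * y ^+ 2.
Proof.
move=> s0 x0 z0 xyz.
have : x ^+ 2 <= (z / 2 + Num.sqrt s * y) ^+ 2.
  by rewrite ler_sqr// nnegrE//; apply: le_trans xyz.
have := sqr_ge0 (z - 4 * (Num.sqrt s * y)).
have -> : 3/4 * (z ^+ 2 / (2 * s)) + 3 * y ^+ 2
    = (3/8 * z ^+ 2 + 3 * (s * y ^+ 2)) / s by field; exact: lt0r_neq0.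
rewrite ler_pM2r ?invr_gt0//.
have -> : s * y ^+ 2 = (Num.sqrt s * y) ^+ 2.
  by rewrite exprMn sqr_sqrtr// ltW.
move: (Num.sqrt s * y) => r; lra.
Qed.

End numeric.

Section dyadic.
Context {R : realType} (X : Type) (tau : R -> X -> X).
Hypothesis tau_add : forall s t x, tau s (tau t x) = tau (s + t) x.
Local Notation V := (X -> R).
Implicit Types f g h : V.
Let T s f : V := fun x => f (tau s x).
Let D s f : V := fun x => f (tau s x) - f x.
Variable L : V -> Prop.
Hypothesis L_lin : forall a f g, L f -> L g -> L (a *: f + g).
Hypothesis L_T : forall s f, L f -> L (fun x => f (tau s x)).
Variable N : V -> R.
Hypothesis N_ge0 : forall f, 0 <= N f.
Hypothesis N_D : forall f g, L f -> L g -> N (f + g) <= N f + N g.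
Hypothesis N_Z : forall a f, L f -> N (a *: f) = `|a| * N f.
Hypothesis N_T : forall s f, L f -> N (fun x => f (tau s x)) = N f.
Variables (c K : R).
Hypothesis (c0 : 0 < c) (K0 : 0 <= K).
Hypothesis N_convex : forall f g, L f -> L g -> N f = N g ->
  N (2^-1 *: (f + g)) ^+ 2 + c * N (f - g) ^+ 2 <= N f ^+ 2.
Variable W : V -> V -> V -> Prop.
Hypothesis WL : forall f g h, W f g h -> [/\ L f, L g & L h].
Hypothesis W_lin : forall a f g h f' g' h', W f g h -> W f' g' h' ->
  W (a *: f + f') (a *: g + g') (a *: h + h').
Hypothesis W_T : forall s f g h, W f g h -> W (T s f) (T s g) (T s h).
Hypothesis W_sqrt : forall s f g h, 0 < s -> W f g h ->
  N (D s f) <= K * Num.sqrt s * (N g + N h).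

Let L_D f g : L f -> L g -> L (f + g).
Proof. by move=> Lf Lg; rewrite -[f]scale1r; exact: L_lin. Qed.

Let L_Z a f : L f -> L (a *: f).
Proof.
move=> Lf; have L0 : L 0 by have := L_lin (-1) f f Lf Lf; rewrite scaleN1r addNr.
by rewrite -[_ *: _]addr0; exact: L_lin.
Qed.

Let L_B f g : L f -> L g -> L (f - g).
Proof. by move=> Lf Lg; rewrite addrC -scaleN1r; exact: L_lin. Qed.

Let L_dif s f : L f -> L (D s f).
Proof. by move=> Lf; apply: L_B => //; exact: L_T. Qed.

Let N_opp f : L f -> N (- f) = N f.
Proof. by move=> Lf; rewrite -scaleN1r N_Z// normrN1 mul1r. Qed.

Let N_B f g : L f -> L g -> N (f - g) <= N f + N g.
Proof.
move=> Lf Lg; rewrite -(N_opp g)//; apply: N_D => //.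
by rewrite -scaleN1r; exact: L_Z.
Qed.

Let N_dif s f : L f -> N (D s f) <= 2 * N f.
Proof.
move=> Lf; have LT := L_T s f Lf.
by rewrite (le_trans (N_B _ _ LT Lf))// N_T// mulrDl mul1r.
Qed.

Variable sigma : R.
Hypothesis sigma0 : 0 < sigma.
Let s i := 2 ^+ i * sigma.
Let s0 i : 0 < s i. Proof. exact: geometric_scale_gt0. Qed.
Let sS i : s i.+1 = s i + s i.
Proof. by rewrite /s exprS -mulrA mulrDl mul1r. Qed.

Let E := fix E i f : V :=
  if i is j.+1 then 2^-1 *: (E j f + T (s j) (E j f)) else f.

Let L_E i f : L f -> L (E i f).
Proof.
by elim: i => //= i IH Lf; apply: L_Z; apply: L_D; [|apply: L_T]; exact: IH.
Qed.

Let mean_sq_le i f : L f ->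
  N (E i.+1 f) ^+ 2 + c * N (D (s i) (E i f)) ^+ 2 <= N (E i f) ^+ 2.
Proof.
move=> Lf; have LE := L_E i f Lf; have LTE := L_T (s i) _ LE.
have := N_convex _ _ LE LTE; rewrite N_T// => /(_ erefl).
suff -> : N (D (s i) (E i f)) = N (E i f - T (s i) (E i f)) by [].
by rewrite -[RHS]N_opp ?opprB//; exact: L_B.
Qed.

Let N_E_le i f : L f -> N (E i f) <= N f.
Proof.
move=> Lf; elim: i => [//|i IH]; apply: le_trans IH.
rewrite -ler_sqr ?nnegrE//.
have := mean_sq_le i f Lf.
have : 0 <= c * N (D (s i) (E i f)) ^+ 2 by rewrite mulr_ge0 ?sqr_ge0// ltW.
lra.
Qed.

(** Telescoping of [mean_sq_le]. *)
Let sum_dif_sq_le M f : L f ->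
  c * \sum_(i < M) N (D (s i) (E i f)) ^+ 2 <= N f ^+ 2.
Proof.
move=> Lf; suff : N (E M f) ^+ 2
    + c * \sum_(i < M) N (D (s i) (E i f)) ^+ 2 <= N f ^+ 2.
  by apply: le_trans; rewrite lerDr sqr_ge0.
elim: M => [|M IH]; first by rewrite big_ord0 mulr0 addr0.
apply: le_trans IH; rewrite big_ord_recr/= mulrDr.
have := mean_sq_le M f Lf; rewrite /=; lra.
Qed.

Let W_dif u f g h : W f g h -> W (D u f) (D u g) (D u h).
Proof.
move=> w; have := W_lin (-1) _ _ _ _ _ _ w (W_T u _ _ _ w).
by rewrite !scaleN1r ![- _ + _]addrC.
Qed.

Let W_E i f g h : W f g h -> W (E i f) (E i g) (E i h).
Proof.
elim: i => //= i IH /IH{IH} w.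
have wT := W_T (s i) _ _ _ w.
have w0 := W_lin (-1) _ _ _ _ _ _ w w.
have w1 := W_lin 1 _ _ _ _ _ _ w wT.
have := W_lin 2^-1 _ _ _ _ _ _ w1 w0.
by rewrite !scaleN1r !scale1r ?[- _ + _]addrC ?subrr ?addr0.
Qed.

(** At scale [i] the difference of a mean is half the one at scale [i + 1] up to
terms in which a further difference appears. On those terms [W_sqrt] can be
used without losing the difference, which is what [sum_dif_sq_le] controls. *)
Let difE i f : D (s i) (E i f) =
  2^-1 *: D (s i.+1) (E i.+1 f) -
  (4^-1 *: D (s i.+1) (D (s i) (E i f)) + 2^-1 *: D (s i) (D (s i) (E i f))).
Proof.
rewrite /=; set y := E i f; rewrite sS; apply/funext => x.
rewrite /T /D !(fctE, scalrfctE)/= !tau_add !addrA.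
by rewrite /GRing.scale/=; field.
Qed.

Let N_dif_mean_step i f g h : W f g h ->
  N (D (s i) (E i f)) <= N (D (s i.+1) (E i.+1 f)) / 2
    + Num.sqrt (s i) * (K * (N (D (s i) (E i g)) + N (D (s i) (E i h)))).
Proof.
move=> w; have [Lf _ _] := WL _ _ _ w.
have wD := W_dif (s i) _ _ _ (W_E i _ _ _ w).
have [LD _ _] := WL _ _ _ wD.
have LE1 : L (D (s i.+1) (E i.+1 f)) by apply/L_dif/L_E.
rewrite {1}difE.
have := W_sqrt (s i) _ _ _ (s0 i) wD.
have := W_sqrt (s i.+1) _ _ _ (s0 i.+1) wD.
set a := N (D (s i) (E i g)) + _.
set y1 := D (s i.+1) (D _ _); set y2 := D (s i) (D _ _).
have Ly1 : L y1 by exact: L_dif.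
have Ly2 : L y2 by exact: L_dif.
have a0 : 0 <= a by rewrite addr_ge0.
have sq : Num.sqrt (s i.+1) <= 2 * Num.sqrt (s i).
  have -> : 2 * Num.sqrt (s i) = Num.sqrt (2 ^+ 2 * s i).
    by rewrite (sqrtrM (s i) (sqr_ge0 2)) sqrtr_sqr ger0_norm.
  by apply: ler_wsqrtr; have := s0 i; rewrite sS; lra.
have Ka : 0 <= K * a by rewrite mulr_ge0.
have : Num.sqrt (s i.+1) * (K * a) <= 2 * Num.sqrt (s i) * (K * a).
  by rewrite ler_wpM2r.
have : N (4^-1 *: y1 + 2^-1 *: y2) <= 4^-1 * N y1 + 2^-1 * N y2.
  apply: le_trans (N_D _ _ (L_Z _ _ Ly1) (L_Z _ _ Ly2)) _.
  by rewrite !N_Z// !ger0_norm ?invr_ge0.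
have := N_B _ _ (L_Z 2^-1 _ LE1) (L_D _ _ (L_Z 4^-1 _ Ly1) (L_Z 2^-1 _ Ly2)).
rewrite N_Z// ger0_norm ?invr_ge0//; lra.
Qed.

Let B f i := N (D (s i) (E i f)) ^+ 2 / s i.

Let B_ge0 f i : 0 <= B f i.
Proof. by apply: divr_ge0; [exact: sqr_ge0|exact: ltW]. Qed.

Let G g h := (N g + N h) ^+ 2.

(** The boundary term of the recursion is at most [12 N(f)^2 / (2^M sigma)],
hence negligible for large [M]. *)
Let sum_B_le m f g h : W f g h ->
  \sum_(i < m) B f i <= 24 * (K ^+ 2 / c) * G g h.
Proof.
move=> w; have [Lf Lg Lh] := WL _ _ _ w.
pose a i := N (D (s i) (E i g)) + N (D (s i) (E i h)).
have suma M : \sum_(i < M) a i ^+ 2 <= 2 / c * G g h.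
  have : \sum_(i < M) a i ^+ 2 <= 2 * \sum_(i < M) N (D (s i) (E i g)) ^+ 2
     + 2 * \sum_(i < M) N (D (s i) (E i h)) ^+ 2.
    rewrite 2!mulr_sumr -big_split/=; apply: ler_sum => i _; rewrite /a.
    move: (N _) (N _) => u v; have := sqr_ge0 (u - v); lra.
  move=> /le_trans; apply.
  rewrite mulrAC ler_pdivlMr// /G.
  have := sum_dif_sq_le M g Lg; have := sum_dif_sq_le M h Lh.
  have : 0 <= N g * N h by rewrite mulr_ge0.
  lra.
have step i : B f i <= 3/4 * B f i.+1 + 3 * (K * a i) ^+ 2.
  have := halving_sq_le _ _ _ _ (s0 i) (N_ge0 _) (N_ge0 _) (N_dif_mean_step i _ _ _ w).
  by rewrite (_ : 2 * s i = s i.+1)// sS; ring.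
have sumB M : \sum_(i < M) B f i <= 3 * B f M + 24 * (K ^+ 2 / c) * G g h.
  apply: le_trans (sum_backward_recursion _ (fun i => 3 * (K * a i) ^+ 2) M _ step) _.
    by move=> i; exact: B_ge0.
  rewrite lerD2l -mulr_sumr.
  under eq_bigr do rewrite exprMn.
  rewrite -mulr_sumr.
  have : K ^+ 2 * \sum_(i < M) a i ^+ 2 <= K ^+ 2 * (2 / c * G g h).
    by rewrite ler_wpM2l ?sqr_ge0.
  have -> : K ^+ 2 * (2 / c * G g h) = 2 * ((K ^+ 2 / c) * G g h).
    by field; exact: lt0r_neq0.
  lra.
have BM M : B f M <= 4 * N f ^+ 2 / sigma / 2 ^+ M.
  have -> : 4 * N f ^+ 2 / sigma / 2 ^+ M = (2 * N f) ^+ 2 / s M.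
    by rewrite /s; field; rewrite !lt0r_neq0// exprn_gt0.
  rewrite /B ler_pM2r ?invr_gt0//.
  have : N (D (s M) (E M f)) <= 2 * N f.
    apply: le_trans (N_dif _ _ (L_E _ _ Lf)) _.
    by rewrite ler_pM2l//; exact: N_E_le.
  by move=> h1; rewrite ler_sqr ?nnegrE ?mulr_ge0.
apply/ler_addgt0Pr => e e0.
pose x := 12 * N f ^+ 2 / sigma / e.
have x0 : 0 <= x.
  apply: divr_ge0; last exact: ltW.
  by apply: divr_ge0; [rewrite pmulr_rge0 ?sqr_ge0|exact: ltW].
pose M := maxn m (Num.truncn x).+1.
have : \sum_(i < m) B f i <= \sum_(i < M) B f i.
  rewrite -!(big_mkord xpredT (B f)) (big_cat_nat (leq0n m) (leq_maxl _ _))/=.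
  by rewrite lerDl sumr_ge0.
move=> /le_trans; apply.
apply: le_trans (sumB M) _; rewrite addrC lerD2l.
have xM : x < 2 ^+ M.
  have /andP[_ /lt_le_trans] := truncn_itv x0; apply.
  rewrite -natrX ler_nat; apply: leq_trans (ltnW (ltn_expl _ _)) => //.
  exact: leq_maxr.
have : 3 * B f M <= 3 * (4 * N f ^+ 2 / sigma / 2 ^+ M) by rewrite ler_pM2l.
move=> /le_trans; apply.
have -> : 3 * (4 * N f ^+ 2 / sigma / 2 ^+ M) = x * e / 2 ^+ M.
  by rewrite /x; field; rewrite !lt0r_neq0// exprn_gt0.
by rewrite ler_pdivrMr ?exprn_gt0// mulrC ler_pM2l// ltW.
Qed.

(** Since [E i f - E i.+1 f] is minus half of [D (s i) (E i f)], this is the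
telescoping sum of the [E i f]. *)
Let N_dif_le_sum m u f : L f ->
  N (D u f) <= N (D u (E m f)) + \sum_(i < m) N (D (s i) (E i f)).
Proof.
move=> Lf; elim: m => [|m IH]; first by rewrite big_ord0 addr0.
apply: le_trans IH _; rewrite big_ord_recr/= addrA addrAC lerD2r.
have LE := L_E m _ Lf; set d := D (s m) (E m f).
have Ld : L d by exact: L_dif.
have -> : D u (E m f) = D u (E m.+1 f) - 2^-1 *: D u d.
  rewrite /= /d; apply/funext => x.
  by rewrite /T /D !(fctE, scalrfctE)/= /GRing.scale/=; field.
have LE1 : L (D u (E m.+1 f)) by apply/L_dif/L_E.
apply: le_trans (N_B _ _ LE1 (L_Z _ _ (L_dif u _ Ld))) _.
rewrite lerD2l N_Z ?ger0_norm ?invr_ge0//; last exact: L_dif.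
by rewrite ler_pdivrMl//; exact: N_dif.
Qed.

Let sum_dif_le m f g h : W f g h ->
  \sum_(i < m) N (D (s i) f) ^+ 2 / s i <= 288 * (K ^+ 2 / c) * G g h.
Proof.
move=> w; have [Lf _ _] := WL _ _ _ w.
pose S i := \sum_(j < i) N (D (s j) (E j f)).
have SS i : S i.+1 = S i + N (D (s i) (E i f)) by rewrite /S big_ord_recr.
have := sum_forward_recursion _ _ _ m sigma0 SS.
rewrite /S big_ord0 expr0n/= mul0r mulr0 add0r -/S -/(s _).
have := sum_B_le m _ _ _ w.
rewrite big_ord_recl /S big_ord0 expr0n/= mul0r add0r -/S => sB sS2.
have : \sum_(i < m) N (D (s i) f) ^+ 2 / s i
    <= 2 * \sum_(i < m) S i.+1 ^+ 2 / s i.+1.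
  rewrite mulr_sumr; apply: ler_sum => i _.
  have -> : 2 * (S i.+1 ^+ 2 / s i.+1) = S i.+1 ^+ 2 / s i.
    by rewrite sS; field; rewrite !lt0r_neq0 ?addr_gt0.
  rewrite ler_pM2r ?invr_gt0// ler_sqr ?nnegrE//; last by rewrite sumr_ge0.
  by rewrite SS addrC; exact: N_dif_le_sum.
by move: sB sS2; rewrite /B /s; lra.
Qed.

(** The bound [M m] is uniform in [t <= 2^m sigma]: a binary expansion writes
[t] as a sum of some [s i] with [i < m] and of a remainder below [sigma], on
which [W_sqrt] is used. *)
Lemma dyadic_vertical_bound f g h : W f g h ->
  exists M : R^nat,
    (forall m t, 0 < t <= 2 ^+ m * sigma ->
      N (fun x => f (tau t x) - f x) <= M m) /\
    (forall m, \sum_(i < m) M i ^+ 2 / (2 ^+ i * sigma)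
      <= K ^+ 2 * (4 + 1728 / c) * (N g + N h) ^+ 2).
Proof.
move=> w; have [Lf Lg Lh] := WL _ _ _ w.
pose M m := K * Num.sqrt sigma * (N g + N h) + \sum_(i < m) N (D (s i) f).
have MS m : M m.+1 = M m + N (D (s m) f) by rewrite /M big_ord_recr addrA.
exists M; split => m.
  elim: m => [|m IH] t /andP[t0 tm].
    apply: le_trans (W_sqrt _ _ _ _ t0 w) _.
    rewrite /M big_ord0 addr0 ler_wpM2r ?addr_ge0// ler_wpM2l// ler_wsqrtr//.
    by rewrite -[leRHS]mul1r -(expr0 2).
  have [tsm|smt] := leP t (s m).
    by apply: (le_trans (IH t _)); rewrite ?t0// MS lerDl.
  have -> : (fun x => f (tau t x) - f x) = T (s m) (D (t - s m) f) + D (s m) f.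
    apply/funext => x; rewrite !fctE /T /D tau_add subrK.
    by rewrite addrA subrK.
  apply: (le_trans (N_D _ _ (L_T _ _ (L_dif _ _ Lf)) (L_dif _ _ Lf))).
  rewrite MS lerD2r N_T; last exact: L_dif.
  by apply: IH; rewrite subr_gt0 smt/= lerBlDr -sS.
have := sum_forward_recursion _ _ _ m sigma0 MS.
have := sum_dif_le m _ _ _ w.
have -> : M 0%N ^+ 2 / sigma = K ^+ 2 * (N g + N h) ^+ 2.
  rewrite /M big_ord0 addr0 !exprMn sqr_sqrtr ?ltW//.
  by field; exact: lt0r_neq0.
have : \sum_(i < m) M i ^+ 2 / s i <= \sum_(i < m.+1) M i ^+ 2 / s i.
  by rewrite [leRHS]big_ord_recr/= lerDl; apply: divr_ge0; [exact: sqr_ge0|exact: ltW].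
have -> : K ^+ 2 * (4 + 1728 / c) * (N g + N h) ^+ 2 =
   4 * (K ^+ 2 * (N g + N h) ^+ 2) + 6 * (288 * (K ^+ 2 / c) * G g h).
  by rewrite /G; field; exact: lt0r_neq0.
by rewrite /s; lra.
Qed.
End dyadic.

(** * The norm of L^p and its uniform convexity *)

Set Implicit Arguments.
Unset Strict Implicit.
Unset Printing Implicit Defensive.

Section Lp_norm.
Context d (T : measurableType d) {R : realType}.
Variable mu : {measure set T -> \bar R}.
Variable p : R.
Hypothesis p1 : 1 <= p.
Implicit Types f g : T -> R.

Definition Lp_norm f : R := fine ('N[mu]_p%:E[EFin \o f])%E.

Let p0 : 0 < p. Proof. exact: lt_le_trans p1. Qed.
Let pe1 : (1 <= p%:E)%E. Proof. by rewrite lee_fin. Qed.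

Lemma Lfun_measurable f : f \in Lfun mu p%:E -> measurable_fun setT f.
Proof. by rewrite inE => /andP[/[!inE]]. Qed.

Lemma Lp_normE f : f \in Lfun mu p%:E ->
  'N[mu]_p%:E[EFin \o f]%E = (Lp_norm f)%:E.
Proof.
rewrite inE => /andP[_]; rewrite inE/= => h.
by rewrite /Lp_norm fineK// ge0_fin_numE ?Lnorm_ge0.
Qed.

Lemma Lp_norm_ge0 f : 0 <= Lp_norm f.
Proof. exact/fine_ge0/Lnorm_ge0. Qed.

Lemma measurable_powR_norm f : measurable_fun setT f ->
  measurable_fun setT (fun x => `|f x| `^ p).
Proof.
move=> mf; apply: (measurableT_comp (measurable_powR p)).
exact: measurableT_comp.
Qed.

Lemma integral_powR_norm f : f \in Lfun mu p%:E ->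
  (\int[mu]_x (`|f x| `^ p)%:E = (Lp_norm f `^ p)%:E)%E.
Proof.
by move=> Lf; rewrite -poweR_EFin -Lp_normE// poweR_Lnorm ?gt_eqF.
Qed.

Lemma Lfun_finite f : measurable_fun setT f ->
  (\int[mu]_x (`|f x| `^ p)%:E < +oo)%E -> f \in Lfun mu p%:E.
Proof.
move=> mf fin; rewrite inE; apply/andP; split; first by rewrite inE.
by rewrite inE/= /finite_norm unlock poweR_lty.
Qed.

(** Also meant for integrals bounded by means other than a pointwise domination. *)
Lemma Lp_norm_le f (r : R) : 0 <= r -> f \in Lfun mu p%:E ->
  (\int[mu]_x (`|f x| `^ p)%:E <= (r `^ p)%:E)%E -> Lp_norm f <= r.
Proof.
move=> r0 Lf; rewrite integral_powR_norm// lee_fin; apply: contraTT.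
rewrite -!ltNge => h; apply: gt0_ltr_powR => //.
by rewrite nnegrE Lp_norm_ge0.
Qed.

Lemma Lfun_lin a f g : f \in Lfun mu p%:E -> g \in Lfun mu p%:E ->
  a *: f + g \in Lfun mu p%:E.
Proof. by move=> Lf Lg; have [_ H] := @Lfun_submod_closed _ _ _ mu _ pe1; apply: H. Qed.

Lemma Lp_normD f g : f \in Lfun mu p%:E -> g \in Lfun mu p%:E ->
  Lp_norm (f + g) <= Lp_norm f + Lp_norm g.
Proof.
move=> Lf Lg.
have LD : f + g \in Lfun mu p%:E by rewrite -[f]scale1r; exact: Lfun_lin.
rewrite -lee_fin EFinD -!Lp_normE//.
by apply: minkowski_EFin => //; exact: Lfun_measurable.
Qed.

Lemma Lp_normZ a f : f \in Lfun mu p%:E -> Lp_norm (a *: f) = `|a| * Lp_norm f.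
Proof.
move=> Lf; have LZ : a *: f \in Lfun mu p%:E.
  have L0 := Lfun_lin (-1) Lf Lf; rewrite scaleN1r addNr in L0.
  by rewrite -[_ *: _]addr0; exact: Lfun_lin.
apply: EFin_inj; rewrite EFinM -!Lp_normE//.
exact: (LnormZ (Lfun_Sub pe1 Lf)).
Qed.

Lemma Lp_norm_homo f g : (forall x, `|f x| <= `|g x|) ->
  measurable_fun setT f -> g \in Lfun mu p%:E ->
  f \in Lfun mu p%:E /\ Lp_norm f <= Lp_norm g.
Proof.
move=> fg mf Lg; have mg := Lfun_measurable Lg.
have le : (\int[mu]_x (`|f x| `^ p)%:E <= \int[mu]_x (`|g x| `^ p)%:E)%E.
  apply: ge0_le_integral => //.
  - by apply/measurable_EFinP; exact: measurable_powR_norm.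
  - by apply/measurable_EFinP; exact: measurable_powR_norm.
  - move=> x _; rewrite lee_fin; apply: ge0_ler_powR; rewrite ?nnegrE//.
    exact: ltW.
have Lf : f \in Lfun mu p%:E.
  by apply: Lfun_finite => //; apply: le_lt_trans le _; rewrite integral_powR_norm// ltry.
split=> //; apply: Lp_norm_le => //; first exact: Lp_norm_ge0.
by rewrite -integral_powR_norm.
Qed.

End Lp_norm.

Section uniform_convexity.
Context d (T : measurableType d) {R : realType}.
Variable mu : {measure set T -> \bar R}.
Variable p : R.
Hypothesis hp : 1 < p <= 2.
Implicit Types f g : T -> R.
Local Notation N := (Lp_norm mu p).

Let p1 : 1 <= p. Proof. by have /andP[/ltW] := hp. Qed.
Let k : R := 16 / (p - 1) ^+ 2.
Let k0 : 0 < k.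
Proof. by rewrite divr_gt0// exprn_gt0// subr_gt0; have /andP[] := hp. Qed.

Let mpow h : h \in Lfun mu p%:E -> measurable_fun setT (fun x => (`|h x| `^ p)%:E).
Proof.
move=> Lh; apply/measurable_EFinP; apply: measurable_powR_norm.
exact: Lfun_measurable Lh.
Qed.

Let mpowZ h r : h \in Lfun mu p%:E ->
  measurable_fun setT (fun x => (r%:E * (`|h x| `^ p)%:E)%E).
Proof. by move=> /mpow mh; exact: measurable_funeM. Qed.

Let integrate_powR (h1 h2 f g : T -> R) (a b c : R) :
  0 <= a -> 0 <= b -> 0 <= c ->
  h1 \in Lfun mu p%:E -> h2 \in Lfun mu p%:E ->
  f \in Lfun mu p%:E -> g \in Lfun mu p%:E ->
  (forall x, a * `|h1 x| `^ p + b * `|h2 x| `^ p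
    <= c * (`|f x| `^ p + `|g x| `^ p)) ->
  a * N h1 `^ p + b * N h2 `^ p <= c * (N f `^ p + N g `^ p).
Proof.
move=> a0 b0 c0 L1 L2 Lf Lg le_h.
have nn (h : T -> R) x : (0 <= (`|h x| `^ p)%:E)%E by rewrite lee_fin powR_ge0.
rewrite -lee_fin EFinD !EFinM EFinD -!integral_powR_norm//.
rewrite -[X in (_ <= _ * X)%E]ge0_integralD//; [|exact: mpow..].
have mD : measurable_fun setT (fun x => ((`|f x| `^ p)%:E + (`|g x| `^ p)%:E)%E).
  exact: (emeasurable_funD (mpow Lf) (mpow Lg)).
have nnD x : (0 <= (`|f x| `^ p)%:E + (`|g x| `^ p)%:E)%E by exact: adde_ge0.
rewrite -!ge0_integralZl_EFin//; try exact: mpow.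
rewrite -ge0_integralD//; last 4 first.
- by move=> x _; rewrite mule_ge0.
- exact: mpowZ.
- by move=> x _; rewrite mule_ge0.
- exact: mpowZ.
apply: ge0_le_integral => //.
- by move=> x _; rewrite adde_ge0// mule_ge0.
- exact: (emeasurable_funD (mpowZ _ L1) (mpowZ _ L2)).
- exact: (measurable_funeM _ mD).
- by move=> x _; rewrite -!EFinM -!EFinD lee_fin.
Qed.

(** The two-point inequality integrated over the space. *)
Let powR_dist_le_norm f g t : 0 < t ->
  f \in Lfun mu p%:E -> g \in Lfun mu p%:E ->
  t `^ (2 - p) * N (f - g) `^ p + k * N (2^-1 *: (f + g)) `^ p <=
  (t ^+ 2 + k / 2) * (N f `^ p + N g `^ p).
Proof.
move=> t0 Lf Lg.
have LB : f - g \in Lfun mu p%:E by rewrite addrC -scaleN1r; exact: Lfun_lin.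
have LD : f + g \in Lfun mu p%:E by rewrite -[f]scale1r; exact: Lfun_lin.
have LM : 2^-1 *: (f + g) \in Lfun mu p%:E.
  have L0 := Lfun_lin p1 (-1) Lf Lf; rewrite scaleN1r addNr in L0.
  by rewrite -[_ *: _]addr0; exact: Lfun_lin.
apply: integrate_powR => //; first exact: powR_ge0.
- exact: ltW.
- by rewrite addr_ge0 ?sqr_ge0// ltW// divr_gt0.
move=> x; have := powR_dist_le_gap _ (f x) (g x) _ hp t0.
rewrite /midpoint_gap -/k !(fctE, scalrfctE)/= /GRing.scale/= [2^-1 * _]mulrC; lra.
Qed.

(** With [n], [m], [d'] the norms of [f], of the midpoint and of the difference,
the integrated two-point inequality at [t = s / n] forces [d' <= (2 + k) s] for
every [s > 0] such that [n^2 - m^2 <= s^2]. *)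
Lemma Lp_uniform_convexity f g :
  f \in Lfun mu p%:E -> g \in Lfun mu p%:E -> N f = N g ->
  N (2^-1 *: (f + g)) ^+ 2 + ((2 + k) ^+ 2)^-1 * N (f - g) ^+ 2 <= N f ^+ 2.
Proof.
move=> Lf Lg fg; have /andP[pgt1 p2] := hp.
have LN : -1 *: g \in Lfun mu p%:E.
  have L0 := Lfun_lin p1 (-1) Lf Lf; rewrite scaleN1r addNr in L0.
  by rewrite -[_ *: _]addr0; exact: Lfun_lin.
have LD : f + g \in Lfun mu p%:E by rewrite -[f]scale1r; exact: Lfun_lin.
have mN : N (2^-1 *: (f + g)) <= N f.
  rewrite Lp_normZ// ger0_norm ?invr_ge0// ler_pdivrMl//.
  by rewrite (le_trans (Lp_normD p1 Lf Lg))// -fg mulrDl mul1r.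
have dN : N (f - g) <= 2 * N f.
  rewrite -[- g]scaleN1r (le_trans (Lp_normD p1 Lf LN))//.
  by rewrite Lp_normZ// normrN1 mul1r -fg mulrDl mul1r.
have key t t0 := @powR_dist_le_norm f g t t0 Lf Lg; move: key; rewrite -fg.
have := Lp_norm_ge0 mu p (f - g).
have := Lp_norm_ge0 mu p (2^-1 *: (f + g)).
have := Lp_norm_ge0 mu p f.
move: (N f) (N (f - g)) (N (_ *: _)) mN dN => n d' m mn dn n0 m0 d0 key.
have [nE0|nN0] := eqVneq n 0.
  have -> : d' = 0 by apply/eqP; rewrite eq_le d0 andbT (le_trans dn)// nE0 mulr0.
  by rewrite expr0n/= mulr0 addr0 ler_sqr ?nnegrE.
have ngt0 : 0 < n by rewrite lt_neqAle eq_sym nN0.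
have sq y : 0 < y -> y `^ (2 - p) * y `^ p = y ^+ 2.
  move=> y0; rewrite -powRD; first by rewrite subrK powR_mulrn// ltW.
  by rewrite (gt_eqF y0) implybT.
have p0 : 0 < p by lra.
have q0 : 0 <= 2 - p by lra.
have msq : m ^+ 2 <= n `^ (2 - p) * m `^ p.
  move: m0; rewrite le_eqVlt => /predU1P[<-|m0].
    by rewrite expr0n/= mulr_ge0// powR_ge0.
  rewrite -[leLHS]sq// ler_wpM2r ?powR_ge0//.
  by apply: ge0_ler_powR => //; rewrite nnegrE ltW.
have ds s : 0 < s -> n ^+ 2 - m ^+ 2 <= s ^+ 2 -> d' <= (2 + k) * s.
  move=> s0 nms.
  have ks : 0 < (2 + k) * s by rewrite mulr_gt0// addr_gt0.
  rewrite leNgt; apply/negP => dlt.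
  have := key (s / n) (divr_gt0 s0 ngt0).
  rewrite -(ler_pM2l (powR_gt0 (2 - p) ngt0)).
  apply/negP; rewrite -ltNge.
  have -> : n `^ (2 - p) * (((s / n) ^+ 2 + k / 2) * (n `^ p + n `^ p)) =
     2 * s ^+ 2 + k * n ^+ 2.
    transitivity (((s / n) ^+ 2 + k / 2) * (2 * (n `^ (2 - p) * n `^ p))); first by ring.
    rewrite sq//.
    by field; exact: nN0.
  have e2 : n `^ (2 - p) * (s / n) `^ (2 - p) = s `^ (2 - p).
    by rewrite -powRM ?(ltW ngt0) ?divr_ge0 ?(ltW s0) ?(ltW ngt0)// mulrC divfK.
  rewrite mulrDr [X in _ < X + _]mulrA e2.
  have : s `^ (2 - p) * ((2 + k) * s) `^ p < s `^ (2 - p) * d' `^ p.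
    rewrite ltr_pM2l ?powR_gt0//; apply: gt0_ltr_powR => //; rewrite nnegrE//.
    exact: ltW.
  have k2 : 1 <= 2 + k by have := k0; lra.
  rewrite powRM ?(ltW s0) ?(le_trans ler01 k2)//.
  rewrite mulrCA sq//.
  have : (2 + k) * s ^+ 2 <= (2 + k) `^ p * s ^+ 2.
    rewrite ler_wpM2r ?sqr_ge0//; exact: le1r_powR.
  have : k * m ^+ 2 <= n `^ (2 - p) * (k * m `^ p).
    by rewrite [n `^ _ * (k * _)]mulrCA ler_pM2l.
  have : k * n ^+ 2 - k * m ^+ 2 <= k * s ^+ 2 by rewrite -mulrBr ler_pM2l.
  lra.
have K0 : 0 < (2 + k) ^+ 2 by rewrite exprn_gt0// addr_gt0.
apply/ler_addgt0Pr => e e0.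
have nm : 0 <= n ^+ 2 - m ^+ 2 by rewrite subr_ge0 ler_sqr.
have s2 : 0 < n ^+ 2 - m ^+ 2 + e by rewrite ltr_wpDl.
have := ds (Num.sqrt (n ^+ 2 - m ^+ 2 + e)).
rewrite sqrtr_gt0 s2 sqr_sqrtr ?(ltW s2)// lerDl (ltW e0) => /(_ isT isT) dd.
have : d' ^+ 2 <= (2 + k) ^+ 2 * (n ^+ 2 - m ^+ 2 + e).
  rewrite -[X in _ * X]sqr_sqrtr ?(ltW s2)// -exprMn ler_sqr ?nnegrE//.
  exact: le_trans dd.
by rewrite -ler_pdivrMl//; lra.
Qed.

End uniform_convexity.

(** * Invariance of Lebesgue measure under the flows of the Heisenberg group *)

Section translation.
Context {R : realType}.
Local Open Scope ereal_scope.

Lemma ge0_integral_translation (F : R -> \bar R) (a : R) :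
  measurable_fun setT F -> (forall x, 0 <= F x) ->
  \int[@lebesgue_measure R]_x F (x + a)%R = \int[@lebesgue_measure R]_x F x.
Proof.
move=> mF F0.
pose tr : measurableTypeR R -> measurableTypeR R := fun x => (x + a)%R.
have mtr : measurable_fun setT tr by exact: measurable_funD.
transitivity (\int[pushforward (@lebesgue_measure R) tr]_x F x).
  by rewrite ge0_integral_pushforward.
apply: eq_measure_integral => //= A mA _; apply/esym.
apply: lebesgue_measure_unique => //= _ [[b c]] _ <-.
rewrite /pushforward (_ : tr @^-1` _ = [set` `](b - a)%R, (c - a)%R]]); last first.
  by apply/seteqP; split => x /=; rewrite !in_itv/= ltrBlDr lerBrDr.
rewrite !lebesgue_measure_itv/= !lte_fin ltrD2r.
by case: ifP => // _; rewrite -!EFinB opprB addrA subrK.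
Qed.

(** Lebesgue measure on [R^(m+1)] is built as a product, whence Tonelli. *)
Lemma ge0_integral_rVS m (F : 'rV[R]_m.+1 -> \bar R) :
  measurable_fun setT F -> (forall x, 0 <= F x) ->
  \int[lebesgue_rV R m.+1]_x F x =
  \int[@lebesgue_measure R]_a \int[lebesgue_rV R m]_z F (rV_cons (a, z)).
Proof.
move=> mF F0.
have mFc : measurable_fun setT (F \o @rV_cons R m).
  exact: (measurableT_comp mF (@measurable_rV_cons R m)).
rewrite -(fubini_tonelli1 (F \o @rV_cons R m))//; last by move=> x; exact: F0.
rewrite -(@ge0_integral_pushforward _ _ _ _ R _ (@measurable_rV_cons R m)
  (@lebesgue_measure R \x lebesgue_rV R m) setT F)//.
Qed.

Lemma ge0_integral_rV_translation m (F : 'rV[R]_m -> \bar R) (v : 'rV[R]_m) :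
  measurable_fun setT F -> (forall x, 0 <= F x) ->
  \int[lebesgue_rV R m]_x F (x + v)%R = \int[lebesgue_rV R m]_x F x.
Proof.
elim: m F v => [|m IH] F v mF F0.
  by apply: eq_integral => x _; congr F; apply/rowP => -[].
have mtr k (w : 'rV[R]_k) : measurable_fun setT (fun x : 'rV[R]_k => (x + w)%R).
  apply/measurable_fun_rVP => i.
  rewrite (_ : _ \o _ = fun x : 'rV[R]_k => (@rV_coor R k i x + w ord0 i)%R).
    by apply: measurable_funD => //; exact: measurable_rV_coor.
  by apply/funext => x; rewrite /rV_coor/= mxE.
rewrite !ge0_integral_rVS//; last exact: (measurableT_comp mF (mtr _ v)).
pose H a := \int[lebesgue_rV R m]_z F (rV_cons (a, z)).
have mc : measurable_fun setT (F \o @rV_cons R m).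
  exact: (measurableT_comp mF (@measurable_rV_cons R m)).
rewrite -(@ge0_integral_translation H (v ord0 ord0)); last first.
- by move=> a; exact: integral_ge0.
- by apply: (measurable_fun_fubini_tonelli_F (F \o @rV_cons R m)) => // x; exact: F0.
apply: eq_integral => a _; rewrite /H.
pose w : 'rV[R]_m := \row_j v ord0 (lift ord0 j).
rewrite -(IH (fun z => F (rV_cons ((a + v ord0 ord0)%R, z))) w)//; last first.
  exact: (measurable_fun_pair2 _ mc).
apply: eq_integral => z _; congr F; apply/rowP => i; rewrite !mxE.
by case: unliftP => [j ->|->]; rewrite /= ?mxE.
Qed.

End translation.

Section preserving.
Context d (T : measurableType d) {R : realType} (mu : {measure set T -> \bar R}).
Implicit Types (phi : T -> T) (p : R).

(** Stated on nonnegative integrands rather than on sets: this is the form that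
Tonelli produces and that the estimates use. *)
Definition measure_preserving phi : Prop :=
  measurable_fun setT phi /\
  forall F : T -> \bar R, measurable_fun setT F -> (forall x, (0 <= F x)%E) ->
    (\int[mu]_x F (phi x) = \int[mu]_x F x)%E.

Lemma measure_preserving_comp phi psi : measure_preserving phi ->
  measure_preserving psi -> measure_preserving (phi \o psi).
Proof.
move=> [m1 h1] [m2 h2]; split; first exact: measurableT_comp.
move=> F mF F0; rewrite -(h1 F)// -(h2 (fun x => F (phi x)))//.
exact: measurableT_comp mF m1.
Qed.

Variable phi : T -> T.
Hypothesis phiP : measure_preserving phi.

Lemma integral_preserving (F : T -> \bar R) : measurable_fun setT F ->
  (\int[mu]_x F (phi x) = \int[mu]_x F x)%E.
Proof.
move=> mF; have [mphi h] := phiP; rewrite [RHS]integralE [LHS]integralE.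
have mp := measurable_funepos mF; have mn := measurable_funeneg mF.
by rewrite -(h _ mp)// -(h _ mn)// -[X in (X^\+)%E]/(F \o phi) funepos_comp funeneg_comp.
Qed.

Lemma Lp_preserving p (f : T -> R) : 1 <= p -> f \in Lfun mu p%:E ->
  (fun x => f (phi x)) \in Lfun mu p%:E
  /\ Lp_norm mu p (fun x => f (phi x)) = Lp_norm mu p f.
Proof.
move=> p1 Lf; have mf := Lfun_measurable Lf; have [mphi h] := phiP.
have E : (\int[mu]_x (`|f (phi x)| `^ p)%:E = \int[mu]_x (`|f x| `^ p)%:E)%E.
  apply: (h (fun x => (`|f x| `^ p)%:E)) => [|x]; last by rewrite lee_fin powR_ge0.
  by apply/measurable_EFinP; exact: measurable_powR_norm.
have Lfp : (fun x => f (phi x)) \in Lfun mu p%:E.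
  apply: Lfun_finite; first exact: measurableT_comp mf mphi.
  by rewrite E integral_powR_norm// ltry.
split=> //; apply/eqP; rewrite eq_le; apply/andP; split.
- by apply: Lp_norm_le; rewrite ?Lp_norm_ge0// E integral_powR_norm.
- by apply: Lp_norm_le; rewrite ?Lp_norm_ge0// -E integral_powR_norm.
Qed.

End preserving.

Section heis.
Context {R : realType} (n : nat).
Local Notation H := ('rV[R]_(n + n) * measurableTypeR R)%type.
Local Notation mu := (lebesgue_heis R n).
Implicit Types (i : 'I_(n + n)) (r s : R).

Lemma ge0_integral_heis (F : H -> \bar R) :
  measurable_fun setT F -> (forall x, (0 <= F x)%E) ->
  (\int[mu]_x F x
   = \int[lebesgue_rV R (n + n)]_z \int[@lebesgue_measure R]_t F (z, t))%E.
Proof. by move=> mF F0; exact: fubini_tonelli1. Qed.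

(** The coefficient of [d/dt] in the field [X_i]. *)
Definition hcoef i (z : 'rV[R]_(n + n)) : R :=
  match fintype.split i with
  | inl j => - (2^-1 * z ord0 (rshift n j))
  | inr j => 2^-1 * z ord0 (lshift n j)
  end.

(** The flow of [X_i], that is, right translation by [exp (r X_i)]. *)
Definition hflow i r (x : heis R n) : heis R n :=
  (x.1 + r *: delta_mx ord0 i, x.2 + r * hcoef i x.1).

(** Right translation by the central point [(0, s)]. *)
Definition vshift s (x : heis R n) : heis R n := (x.1, x.2 + s).

Lemma measurable_coord i : measurable_fun setT (fun z : 'rV[R]_(n + n) => z ord0 i : R).
Proof. exact: measurable_rV_coor. Qed.

Lemma measurable_hcoef i : measurable_fun setT (hcoef i).
Proof.
rewrite /hcoef; case: fintype.split => j.
- apply: measurableT_comp => //; apply: measurable_funM => //; exact: measurable_coord.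
- apply: measurable_funM => //; exact: measurable_coord.
Qed.

Lemma measurable_heisP d (T : measurableType d) (f : T -> H) :
  measurable_fun setT f <->
  (forall i, measurable_fun setT (fun x => (f x).1 ord0 i : R)) /\
  measurable_fun setT (fun x => (f x).2 : R).
Proof.
split=> [/measurable_fun_pairP[m1 m2]|[m1 m2]].
  by split=> // i; apply: ((measurable_fun_rVP _).1 m1 i).
by apply/measurable_fun_pairP; split => //; exact/measurable_fun_rVP.
Qed.

Lemma measurable_hflow2 i :
  measurable_fun setT (fun ux : measurableTypeR R * H => hflow i ux.1 ux.2 : H).
Proof.
have m2 : measurable_fun setT (fun ux : measurableTypeR R * H => ux.2.1).
  exact: measurableT_comp.
apply/measurable_heisP; split=> [j|]/=.
  under eq_fun do rewrite mxE mxE.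
  apply: measurable_funD.
    exact: (measurableT_comp (measurable_coord j) m2).
  by apply: measurable_funM.
apply: measurable_funD; first exact: measurableT_comp.
apply: measurable_funM => //.
exact: (measurableT_comp (measurable_hcoef i) m2).
Qed.

Lemma measurable_hflow i r : measurable_fun setT (hflow i r : H -> H).
Proof. exact: (measurable_fun_pair2 _ (measurable_hflow2 i)). Qed.

Lemma measurable_vshift2 :
  measurable_fun setT (fun ux : measurableTypeR R * H => vshift ux.1 ux.2 : H).
Proof.
have m2 : measurable_fun setT (fun ux : measurableTypeR R * H => ux.2.1).
  exact: measurableT_comp.
apply/measurable_heisP; split=> [j|]/=.
  exact: (measurableT_comp (measurable_coord j) m2).
by apply: measurable_funD => //; exact: measurableT_comp.
Qed.

Lemma measurable_vshift s : measurable_fun setT (vshift s : H -> H).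
Proof. exact: (measurable_fun_pair2 _ measurable_vshift2). Qed.

Lemma vshift_preserving s : measure_preserving mu (vshift s).
Proof.
split=> [|F mF F0]; first exact: measurable_vshift.
rewrite (ge0_integral_heis (F := fun x => F (vshift s x)))//; last first.
  exact: measurableT_comp mF (measurable_vshift s).
rewrite (ge0_integral_heis mF)//.
apply: eq_integral => z _.
rewrite -(@ge0_integral_translation _ (fun t => F (z, t)) s)//.
exact: (measurable_fun_pair2 _ mF).
Qed.

(** A shear: for fixed [z] the flow translates [t], and it translates [z] by a
constant vector. *)
Lemma hflow_preserving i r : measure_preserving mu (hflow i r).
Proof.
split=> [|F mF F0]; first exact: measurable_hflow.
rewrite (ge0_integral_heis (F := fun x => F (hflow i r x)))//; last first.
  exact: measurableT_comp mF (measurable_hflow i r).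
rewrite (ge0_integral_heis mF)//.
pose G z := (\int[@lebesgue_measure R]_t F (z, t))%E.
rewrite -[RHS](@ge0_integral_rV_translation _ _ G (r *: delta_mx ord0 i)); last first.
- by move=> z; exact: integral_ge0.
- exact: (measurable_fun_fubini_tonelli_F F).
apply: eq_integral => z _; rewrite /G.
rewrite -(@ge0_integral_translation _ (fun t => F (_, t)) (r * hcoef i z))//.
exact: (measurable_fun_pair2 _ mF).
Qed.

Lemma vshift_add s t x : vshift s (vshift t x) = vshift (s + t) x.
Proof. by rewrite /vshift/= addrAC -addrA. Qed.

(** [hcoef i] is a multiple of the coordinate paired with [i], which the flow of
[X_i] fixes. *)
Lemma hcoef_flow i r z : hcoef i (z + r *: delta_mx ord0 i) = hcoef i z.
Proof.
rewrite /hcoef; case: fintype.splitP => j ij; rewrite !mxE eqxx/=.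
- rewrite (_ : rshift n j == i = false) ?mulr0 ?addr0//.
  by apply/negbTE/eqP => /(congr1 val)/=; rewrite ij => /eqP; rewrite gtn_eqF// ltn_addr.
- rewrite (_ : lshift n j == i = false) ?mulr0 ?addr0//.
  by apply/negbTE/eqP => /(congr1 val)/=; rewrite ij => /eqP; rewrite ltn_eqF// ltn_addr.
Qed.

Lemma hflow_add i r s x : hflow i r (hflow i s x) = hflow i (r + s) x.
Proof.
rewrite /hflow/= hcoef_flow; congr pair.
  by rewrite -addrA -scalerDl [s + r]addrC.
by rewrite -addrA -mulrDl [s + r]addrC.
Qed.

Lemma hflow0 i x : hflow i 0 x = x.
Proof. by rewrite /hflow scale0r mul0r !addr0; case: x. Qed.

(** The exponentials of [X_j] and [X_(n+j)] generate the centre: this is where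
the exponent [1 / 2] of [t] comes from. *)
Lemma hflow_commutator (j : 'I_n) r x :
  hflow (rshift n j) (- r) (hflow (lshift n j) (- r)
    (hflow (rshift n j) r (hflow (lshift n j) r x))) = vshift (r ^+ 2) x.
Proof.
have cl z : hcoef (lshift n j) z = - (2^-1 * z ord0 (rshift n j)).
  by rewrite /hcoef -/(unsplit (inl j)) unsplitK.
have cr z : hcoef (rshift n j) z = 2^-1 * z ord0 (lshift n j).
  by rewrite /hcoef -/(unsplit (inr j)) unsplitK.
rewrite /hflow /vshift/= !cl !cr !mxE !eqxx/= (_ : rshift n j == lshift n j = false); last first.
  by apply/negbTE/eqP => /(congr1 val)/=/eqP; rewrite gtn_eqF// ltn_addr.
rewrite (_ : lshift n j == rshift n j = false); last first.
  by apply/negbTE/eqP => /(congr1 val)/=/eqP; rewrite ltn_eqF// ltn_addr.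
congr pair; last by rewrite /=; field.
by apply/rowP => k; rewrite !mxE; ring.
Qed.

End heis.

(** * A smooth function vanishing on a half-line *)

Section bump.
Context {R : realType}.
Implicit Types (m : nat) (x : R).

(** The powers of [1 / x] make the family stable under derivation up to linear
combinations; [bump 0] is the usual flat function [exp (- 1 / x)]. *)
Definition bump m x : R := if 0 < x then x^-1 ^+ m * expR (- x^-1) else 0.

Lemma bump_ge0 m x : 0 <= bump m x.
Proof.
rewrite /bump; case: ifPn => // x0.
by rewrite mulr_ge0 ?expR_ge0// exprn_ge0// invr_ge0 ltW.
Qed.

(** Differentiability at [0] with derivative [0] follows. *)
Lemma bump_le_sq m x : bump m x <= m.+2`!%:R * x ^+ 2.
Proof.
rewrite /bump; case: ifPn => [x0|_]; last by rewrite mulr_ge0 ?sqr_ge0.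
have y0 : 0 < x^-1 by rewrite invr_gt0.
have := expR_ge1Dxn m.+1 (ltW y0).
rewrite expRN -[x ^+ 2]invrK -exprVn; move: (x^-1) y0 => y y0 h.
have f0 : 0 < m.+2`!%:R :> R by rewrite ltr0n fact_gt0.
rewrite ler_pdivrMr ?expR_gt0// -(ler_pM2r (exprn_gt0 2 y0)) -exprD addn2.
have : y ^+ m.+2 <= m.+2`!%:R * expR y.
  rewrite [leRHS]mulrC -ler_pdivrMr//; apply: le_trans h.
  by rewrite lerDr.
move: (_`!%:R) (expR y) => a b.
suff -> : a * b = a * (y ^+ 2)^-1 * b * y ^+ 2 by [].
by field; exact: lt0r_neq0.
Qed.

Lemma is_derive_bump m x :
  is_derive x 1 (bump m) (bump m.+2 x - m%:R * bump m.+1 x).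
Proof.
have [x0|x0|->] := ltgtP x 0.
- rewrite {2 3}/bump ltNge (ltW x0)/= mulr0 subr0.
  apply: (@near_eq_is_derive _ _ _ (cst 0)).
  near=> y; rewrite /bump ltNge (_ : y <= 0)//.
  by apply: ltW; near: y; exact: lt_nbhsl.
- rewrite {2 3}/bump x0.
  apply: (@near_eq_is_derive _ R^o R^o (fun y : R => y^-1 ^+ m * expR (- y^-1))).
    near=> y; rewrite /bump (_ : 0 < y)//.
    by near: y; exact: lt_nbhsr.
  have xN0 : x != 0 by rewrite gt_eqF.
  have dV : is_derive x 1 (fun y : R => y^-1) (- x ^- 2).
    have := @is_deriveV _ id x 1 1 xN0 _; rewrite /= scaler1; exact.
  have dE : is_derive x 1 (fun y : R => expR (- y^-1)) (expR (- x^-1) * x ^- 2).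
    have dN := is_deriveN dV.
    have := @is_derive1_comp _ expR (fun y => - y^-1) x _ _ (is_derive_expR _) dN.
    by rewrite opprK.
  have dX := @is_deriveX _ _ (fun y : R => y^-1) m x 1 _ dV.
  rewrite (_ : (fun y => _) =
      (fun y : R => y^-1) ^+ m * (fun y : R => expR (- y^-1))); last first.
    by apply/funext => y; rewrite !fctE.
  have := @is_deriveM _ _ _ _ _ _ _ _ dX dE.
  set u := (X in is_derive _ _ _ X -> _); set v := (X in _ -> is_derive _ _ _ X).
  suff -> : u = v by [].
  rewrite /u /v exprfctE /GRing.scale/=.
  case: m {dX u v} => [|m]; first by rewrite expr0; field.
  rewrite /= !exprS; move: (x^-1 ^+ m) (expR _) => y e.
  field; exact: xN0.
- rewrite {2 3}/bump ltxx mulr0 subr0.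
  have lim0 : h^-1 *: (bump m (h *: 1 + 0) - bump m 0) @[h --> (0 : R)^'] --> (0 : R).
    apply/cvgr0Pnorm_lt => e e0.
    have f0 : 0 < m.+2`!%:R :> R by rewrite ltr0n fact_gt0.
    near=> h.
    have h0 : h != 0 by near: h; exact: nbhs_dnbhs_neq.
    rewrite /GRing.scale/= mulr1 addr0 {2}/bump ltxx subr0 normrM normfV.
    rewrite ltr_pdivrMl ?normr_gt0// ger0_norm ?bump_ge0//.
    apply: le_lt_trans (bump_le_sq m h) _.
    rewrite -(real_normK (num_real h)) expr2 mulrCA ltr_pM2l ?normr_gt0//.
    rewrite -ltr_pdivlMl// mulrC.
    near: h; apply: dnbhs0_lt; exact: divr_gt0.
  by apply: DeriveDef; [exact: cvgP lim0|exact: cvg_lim lim0].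
Unshelve. all: by end_near. Qed.

Lemma derivable_bump m x : derivable (bump m) x 1.
Proof. by have [] := is_derive_bump m x. Qed.

Lemma differentiable_bump m x : differentiable (bump m) x.
Proof. exact/derivable1_diffP/derivable_bump. Qed.

Lemma measurable_bump m : measurable_fun setT (bump m).
Proof.
apply: continuous_measurable_fun => x.
exact/differentiable_continuous/differentiable_bump.
Qed.

End bump.

(** * A class of smooth functions stable under derivation and affine maps *)

Section along_lines.
Context {R : realType} (V : normedModType R).

Lemma is_derive_along_line (f : V -> R) (k : R -> R) (x v : V) (d : R) :
  (forall h, f (h *: v + x) = k h) -> is_derive (0 : R) 1 k d -> is_derive x v f d.
Proof.
move=> fk [ck <-].
have E : (fun h : R => h^-1 *: (f (h *: v + x) - f x))
    = (fun h : R => h^-1 *: (k (h *: 1 + 0) - k 0)).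
  apply/funext => h; rewrite fk -[x in f x]add0r -(scale0r v) fk.
  by rewrite addr0 [h *: 1]mulr1.
by apply: DeriveDef; rewrite /derivable /derive /= ?E//; exact: ck.
Qed.

Lemma eq_derive_along_line (f g : V -> R) (x y v : V) :
  (forall h, f (h *: v + x) = g (h *: v + y)) -> 'D_v f x = 'D_v g y.
Proof.
move=> fg; rewrite /derive /=.
suff -> : (fun h : R => h^-1 *: (f (h *: v + x) - f x))
    = (fun h : R => h^-1 *: (g (h *: v + y) - g y)) by [].
apply/funext => h; rewrite fg -[x in f x]add0r -(scale0r v) fg.
by rewrite scale0r add0r.
Qed.

Lemma is_derive_line (f : V -> R) (x v : V) (u : R) :
  derivable f (x + u *: v) v ->
  is_derive u 1 (fun u => f (x + u *: v)) ('D_v f (x + u *: v)).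
Proof.
move=> df.
have E : (fun h : R => h^-1 *: (f (x + (h *: 1 + u) *: v) - f (x + u *: v)))
    = (fun h : R => h^-1 *: (f (h *: v + (x + u *: v)) - f (x + u *: v))).
  by apply/funext => h; rewrite [h *: 1]mulr1 scalerDl addrCA.
by apply: DeriveDef; rewrite /derivable /derive /= ?E//; exact: df.
Qed.

End along_lines.

Section nice.
Context {R : realType} (n : nat).
Local Notation H := (heis R n).
Implicit Types (phi psi : H -> R) (x v w : H).

Definition linform (a : 'rV[R]_(n + n)) (b : R) x : R :=
  \sum_i a ord0 i * x.1 ord0 i + b * x.2.

(** Smooth functions closed under directional derivatives, products and
composition with affine maps, and measurable for the product sigma-algebra.
Unlike a general smooth function, such a function has directional derivatives
that are visibly linear in the direction. *)
Inductive nice : (H -> R) -> Prop :=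
| nice_affine a b c : nice (fun x => linform a b x + c)
| nice_bump m a b c : nice (fun x => bump m (linform a b x + c))
| nice_add phi psi : nice phi -> nice psi -> nice (phi + psi)
| nice_mul phi psi : nice phi -> nice psi -> nice (phi * psi).

Lemma linform_linear a b (h : R) v x :
  linform a b (h *: v + x) = h * linform a b v + linform a b x.
Proof.
rewrite /linform/= [h * (_ + _)]mulrDr mulr_sumr addrACA -big_split/=; congr (_ + _).
  by apply: eq_bigr => i _; rewrite !mxE; ring.
by rewrite /GRing.scale/=; ring.
Qed.

Lemma nice_cst c : nice (fun=> c).
Proof.
rewrite (_ : (fun=> c) = (fun x => linform 0 0 x + c)); first exact: nice_affine.
apply/funext => x; rewrite /linform mul0r big1 ?addr0 ?add0r// => i _.
by rewrite mxE mul0r.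
Qed.

Lemma nice_scale c phi : nice phi -> nice (c *: phi).
Proof.
move=> h; rewrite (_ : c *: phi = (fun=> c) * phi); last by [].
by apply: nice_mul => //; exact: nice_cst.
Qed.

Lemma continuous_linform a b : continuous (linform a b).
Proof.
move=> x; apply: cvgD.
  apply: cvg_big => [|i _]; first exact: add_continuous.
  apply: cvgMl_tmp.
  apply: (@continuous_comp _ _ _ fst (fun M : 'rV[R]_(n + n) => M ord0 i)).
    exact: cvg_fst.
  exact: coord_continuous.
by apply: cvgMl_tmp; exact: cvg_snd.
Qed.

Lemma nice_continuous phi : nice phi -> continuous phi.
Proof.
have aff a b c : continuous (fun x : H => linform a b x + c).
  by move=> x; apply: cvgD; [exact: continuous_linform|exact: cvg_cst].
elim=> {phi} [a b c|m a b c|phi psi _ c1 _ c2|phi psi _ c1 _ c2] x.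
- exact: aff.
- apply: (@continuous_comp _ _ _ (fun x : H => linform a b x + c) (bump m)); first exact: aff.
  exact/differentiable_continuous/differentiable_bump.
- by apply: cvgD; [exact: c1|exact: c2].
- by apply: cvgM; [exact: c1|exact: c2].
Qed.

Let is_derive_line0 (l k : R) : is_derive (0 : R) (1 : R) (fun h : R => h * l + k : R) l.
Proof.
have dM := @is_deriveZ R R^o R^o id l 0 1 1 (is_derive_id (0 : R^o) (1 : R^o)).
have := is_deriveD dM (is_derive_cst (k : R^o) (0 : R^o) (1 : R^o)).
rewrite addr0 [l%:A]mulr1; congr is_derive.
by apply/funext => h; rewrite !fctE /GRing.scale/= mulrC.
Qed.

Lemma is_derive_affine a b c x v :
  is_derive x v (fun x => linform a b x + c) (linform a b v).
Proof.
apply: (@is_derive_along_line _ _ _ (fun h => h * linform a b v + (linform a b x + c))).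
  by move=> h; rewrite linform_linear -addrA.
exact: is_derive_line0.
Qed.

Lemma is_derive_bump_affine m a b c x v (l := linform a b x + c) :
  is_derive x v (fun x => bump m (linform a b x + c))
    ((bump m.+2 l - m%:R * bump m.+1 l) * linform a b v).
Proof.
pose g (h : R) := h * linform a b v + l.
apply: (@is_derive_along_line _ _ _ (bump m \o g)).
  by move=> h; rewrite linform_linear -addrA.
apply: is_derive1_comp; last exact: is_derive_line0.
by rewrite /g mul0r add0r; exact: is_derive_bump.
Qed.

(** The derivatives are collected in one function [D] so that linearity in the
direction is available in the induction for products. *)
Lemma nice_derivative phi : nice phi -> exists D : H -> H -> R,
  [/\ forall v, nice (D v), forall v x, is_derive x v phi (D v x) &
    forall (h : R) v w x, D (h *: v + w) x = h * D v x + D w x].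
Proof.
elim=> {phi} [a b c|m a b c|phi psi hp [D1 [n1 d1 l1]] hq [D2 [n2 d2 l2]]
  |phi psi hp [D1 [n1 d1 l1]] hq [D2 [n2 d2 l2]]].
- exists (fun v _ => linform a b v); split => [v|v x|h v w x].
  + exact: nice_cst.
  + exact: is_derive_affine.
  + exact: linform_linear.
- exists (fun v x => (bump m.+2 (linform a b x + c)
    - m%:R * bump m.+1 (linform a b x + c)) * linform a b v).
  split => [v|v x|h v w x].
  + apply: (@nice_mul (fun x => bump m.+2 (linform a b x + c)
      - m%:R * bump m.+1 (linform a b x + c)) (fun=> _)); last exact: nice_cst.
    rewrite (_ : (fun x => _) = (fun x => bump m.+2 (linform a b x + c))
      + (- m%:R) *: (fun x => bump m.+1 (linform a b x + c))); last first.
      by apply/funext => x; rewrite !fctE /GRing.scale/= mulNr.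
    by apply: nice_add; [|apply: nice_scale]; exact: nice_bump.
  + exact: is_derive_bump_affine.
  + by rewrite linform_linear; ring.
- exists (fun v => D1 v + D2 v); split => [v|v x|h v w x].
  + exact: nice_add.
  + exact: is_deriveD.
  + by rewrite !fctE l1 l2; ring.
- exists (fun v => phi * D2 v + psi * D1 v); split => [v|v x|h v w x].
  + by apply: nice_add; exact: nice_mul.
  + exact: is_deriveM.
  + by rewrite !fctE l1 l2; ring.
Qed.

Lemma nice_derivable phi x v : nice phi -> derivable phi x v.
Proof. by move=> /nice_derivative[D [_ d _]]; have [] := d v x. Qed.

Lemma nice_D phi v : nice phi -> nice ('D_v phi).
Proof.
move=> /nice_derivative[D [nD d _]].
rewrite (_ : 'D_v phi = D v)//; apply/funext => x.
by have [_] := d v x.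
Qed.

Lemma nice_D_linear phi (h : R) v w x : nice phi ->
  'D_(h *: v + w) phi x = h * 'D_v phi x + 'D_w phi x.
Proof.
move=> /nice_derivative[D [nD d l]].
have E u : 'D_u phi x = D u x by have [_] := d u x.
by rewrite !E l.
Qed.

Lemma nice_smooth phi : nice phi -> smooth phi.
Proof.
move=> nphi s psi; suff : nice psi.
  by move=> npsi; split; [exact: nice_continuous|move=> x v; exact: nice_derivable].
by rewrite /psi; elim: s {psi} => //= v s; exact: nice_D.
Qed.

Lemma measurable_linform a b :
  measurable_fun setT (linform a b : ('rV[R]_(n + n) * measurableTypeR R)%type -> R).
Proof.
apply: measurable_funD; last by apply: measurable_funM => //; exact: measurable_snd.
apply: measurable_sum => i; apply: measurable_funM => //.
apply: (measurableT_comp (measurable_coord i)); exact: measurable_fst.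
Qed.

Lemma nice_measurable phi : nice phi ->
  measurable_fun setT (phi : ('rV[R]_(n + n) * measurableTypeR R)%type -> R).
Proof.
have aff a b c : measurable_fun setT
    ((fun x => linform a b x + c) : ('rV[R]_(n + n) * measurableTypeR R)%type -> R).
  by apply: measurable_funD => //; exact: measurable_linform.
elim=> {phi} [a b c|m a b c|phi psi _ c1 _ c2|phi psi _ c1 _ c2].
- exact: aff.
- exact: (measurableT_comp (measurable_bump m) (aff a b c)).
- exact: measurable_funD.
- exact: measurable_funM.
Qed.

(** Affine maps, described by their action on affine forms. *)
Definition nice_map (A : H -> H) : Prop := forall a b, exists a' b' c',
  forall x, linform a b (A x) = linform a' b' x + c'.

Lemma nice_comp A phi : nice_map A -> nice phi -> nice (fun x => phi (A x)).
Proof.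
move=> affA; elim=> {phi} [a b c|m a b c|phi psi _ c1 _ c2|phi psi _ c1 _ c2].
- have [a' [b' [c' E]]] := affA a b.
  under eq_fun do rewrite E -addrA; exact: nice_affine.
- have [a' [b' [c' E]]] := affA a b.
  under eq_fun do rewrite E -addrA; exact: nice_bump.
- exact: (nice_add c1 c2).
- exact: (nice_mul c1 c2).
Qed.

Lemma linform_coef j : exists a, forall x, hcoef j x.1 = linform a 0 x.
Proof.
have E k (d : R) : exists a, forall x, d * x.1 ord0 k = linform a 0 x.
  exists (d *: delta_mx ord0 k) => x; rewrite /linform mul0r addr0 (bigD1 k)//=.
  rewrite !mxE !eqxx mulr1 big1 ?addr0// => i ik.
  by rewrite !mxE eqxx (negbTE ik) mulr0 mul0r.
rewrite /hcoef; case: fintype.split => k.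
  have [a Ea] := E (rshift n k) (- 2^-1); exists a => x.
  by rewrite -Ea mulNr.
exact: E.
Qed.

Lemma nice_map_hflow i r : nice_map (hflow i r).
Proof.
move=> a b; have [a0 Ea] := linform_coef i.
exists (a + (b * r) *: a0), b, (r * a ord0 i) => x.
rewrite /hflow [in LHS]/linform/= Ea /linform mul0r addr0.
rewrite mulrDr mulrA mulr_sumr.
have -> : \sum_j a ord0 j * (x.1 + r *: delta_mx ord0 i) ord0 j
    = \sum_j a ord0 j * x.1 ord0 j + r * a ord0 i.
  under eq_bigr do rewrite !mxE mulrDr; rewrite big_split/=; congr (_ + _).
  rewrite (bigD1 i)//= eqxx mulr1 big1 ?addr0 1?mulrC// => j ji.
  by rewrite (negbTE ji) !mulr0.
under [in RHS]eq_bigr do rewrite !mxE mulrDl -mulrA.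
by rewrite big_split/=; ring.
Qed.

Lemma nice_map_vshift s : nice_map (vshift s).
Proof. by move=> a b; exists a, b, (b * s) => x; rewrite /linform/= mulrDr addrA. Qed.

End nice.

(** * Test functions on the Heisenberg group *)

Section box.
Context {R : realType} (n : nat).
Local Notation H := (heis R n).
Implicit Types (phi psi : H -> R) (x v w : H) (M r s : R).

(** Boxes rather than balls: they are measurable for the product sigma-algebra
and of finite measure by induction on the dimension. *)
Definition box M : set H :=
  [set x : H | (forall i, `|x.1 ord0 i| <= M) /\ `|x.2| <= M].

Lemma compact_box M : compact (box M).
Proof.
have -> : box M = [set z : 'rV[R]_(n + n) | forall i, `[- M, M]%classic (z ord0 i)] `*` `[- M, M]%classic.
  apply/seteqP; split => -[z t] [/= h1 h2]; split => /= [i|].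
  - by rewrite in_itv/= -ler_norml.
  - by rewrite in_itv/= -ler_norml.
  - by have := h1 i; rewrite in_itv/= -ler_norml.
  - by move: h2; rewrite in_itv/= -ler_norml.
apply: compact_setX; last exact: segment_compact.
apply: (@rV_compact R (n + n) (fun=> `[- M, M]%classic)) => i.
exact: segment_compact.
Qed.

Lemma closed_box M : closed (box M).
Proof. by apply: compact_closed; [exact: norm_hausdorff|exact: compact_box]. Qed.

Lemma box_hflow i r M x : box M x -> box (M + `|r| + `|r| * M) (hflow i r x).
Proof.
move=> [h1 h2]; have M0 : 0 <= M by apply: le_trans h2.
have c1 : `|hcoef i x.1| <= M.
  rewrite /hcoef; case: fintype.split => j.
    rewrite normrN normrM ger0_norm ?invr_ge0//.
    have := h1 (rshift n j); have := normr_ge0 (x.1 ord0 (rshift n j)); lra.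
  rewrite normrM ger0_norm ?invr_ge0//.
  have := h1 (lshift n j); have := normr_ge0 (x.1 ord0 (lshift n j)); lra.
have rM : 0 <= `|r| * M by rewrite mulr_ge0.
have r0 := normr_ge0 r.
split=> [j|] /=.
  rewrite !mxE eqxx/= (le_trans (ler_normD _ _))// normrM.
  have := h1 j; case: (j == i); rewrite ?normr1 ?normr0 ?mulr1 ?mulr0; lra.
rewrite (le_trans (ler_normD _ _))// normrM.
have : `|r| * `|hcoef i x.1| <= `|r| * M by rewrite ler_wpM2l.
lra.
Qed.

Lemma box_vshift s M x : box M x -> box (M + `|s|) (vshift s x).
Proof.
move=> [h1 h2]; split=> [i|] /=; first by rewrite (le_trans (h1 i))// lerDl.
by rewrite (le_trans (ler_normD _ _))// lerD2r.
Qed.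

Let lebesgue_segment_lty M : (@lebesgue_measure R `[(- M)%R, M]%classic < +oo)%E.
Proof. by rewrite lebesgue_measure_itv/=; case: ifP => _; rewrite ltry. Qed.

Lemma lebesgue_rV_box m M :
  measurable [set z : 'rV[R]_m | forall i, `|z ord0 i| <= M] /\
  (lebesgue_rV R m [set z : 'rV[R]_m | forall i, (`|z ord0 i| <= M)%R] < +oo)%E.
Proof.
elim: m => [|m [IHm IH]].
  rewrite (_ : [set z | _] = setT); first by rewrite /= diracT ltry.
  by apply/seteqP; split => // z _ [].
set A := [set z : 'rV[R]_m.+1 | _].
have E : @rV_cons R m @^-1` A =
    `[- M, M]%classic `*` [set z : 'rV[R]_m | forall i, `|z ord0 i| <= M].
  apply/seteqP; split => -[a z].
    move=> h; split; first by have := h ord0; rewrite rV_cons0 /= in_itv/= ler_norml.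
    by move=> i; have := h (lift ord0 i); rewrite rV_consS.
  move=> [/= h1 h2] i; case: (unliftP ord0 i) => [j ->|->].
    by rewrite rV_consS.
  by move: h1; rewrite rV_cons0/= in_itv/= ler_norml.
have mE : measurable (@rV_cons R m @^-1` A) by rewrite E; exact: measurableX.
split.
  have -> : A = @rV_uncons R m @^-1` (@rV_cons R m @^-1` A).
    apply/seteqP; split => z; rewrite /preimage/= /A/=;
      suff -> : rV_cons (rV_uncons z) = z by [].
    - apply/rowP => i; case: (unliftP ord0 i) => [j ->|->].
        by rewrite rV_consS mxE.
      by rewrite rV_cons0.
    - apply/rowP => i; case: (unliftP ord0 i) => [j ->|->].
        by rewrite rV_consS mxE.
      by rewrite rV_cons0.
  by rewrite -[X in measurable X]setTI; exact: measurable_rV_uncons.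
rewrite [ltLHS](_ : _ = (@lebesgue_measure R \x lebesgue_rV R m)%E (@rV_cons R m @^-1` A))//.
rewrite E product_measure1E// lte_mul_pinfty//.
by rewrite ge0_fin_numE//; exact: lebesgue_segment_lty.
Qed.

Let boxE M : box M =
  [set z : 'rV[R]_(n + n) | forall i, `|z ord0 i| <= M] `*` `[- M, M]%classic.
Proof.
apply/seteqP; split => -[z t] [/= h1 h2]; split => //=.
- by rewrite in_itv/= -ler_norml.
- by move: h2; rewrite in_itv/= -ler_norml.
Qed.

Lemma measurable_box M : measurable (box M : set ('rV[R]_(n + n) * measurableTypeR R)).
Proof. by rewrite boxE; apply: measurableX => //; exact: (lebesgue_rV_box _ M).1. Qed.

Lemma lebesgue_box M : (lebesgue_heis R n (box M) < +oo)%E.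
Proof.
have [h1 h2] := lebesgue_rV_box (n + n) M.
rewrite boxE [ltLHS](_ : _ =
  (lebesgue_rV R (n + n) [set z : 'rV[R]_(n + n) | forall i, (`|z ord0 i| <= M)%R]
    * @lebesgue_measure R `[(- M)%R, M]%classic)%E); last exact: product_measure1E.
rewrite lte_mul_pinfty//.
by rewrite ge0_fin_numE.
Qed.

Lemma continuous_bounded_on_box phi M : continuous phi ->
  exists B, 0 <= B /\ forall x, box M x -> `|phi x| <= B.
Proof.
move=> cphi; have [M0|M0] := leP 0 M; last first.
  by exists 0; split => // x [_ /(le_trans (normr_ge0 _))]; rewrite leNgt M0.
have [||c _ h] := @compact_EVT_max H R (fun x => `|phi x|) (box M) _ (@compact_box M).
- by exists 0; split => [i|] /=; rewrite ?mxE normr0.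
- apply: continuous_subspaceT => x.
  by apply: cvg_norm; exact: cphi.
by exists `|phi c|; split => // x bx; apply: h; rewrite inE.
Qed.

(** Test functions among the nice ones, with an explicit bound on the support. *)
Definition htest phi := nice phi /\ exists M, forall x, phi x != 0 -> box M x.

Lemma htest_test_function phi : htest phi -> test_function phi.
Proof.
move=> [nphi [M h]]; split; first exact: nice_smooth.
apply: (subclosed_compact _ (@compact_box M)); first exact: closed_closure.
rewrite [X in _ `<=` X](closure_id _).1; last exact: closed_box.
by apply: closureS => x; exact: h.
Qed.

Lemma htest_bounded phi : htest phi -> exists M B, [/\ 0 <= B,
  forall x, ~ box M x -> phi x = 0 & forall x, `|phi x| <= B].
Proof.
move=> [nphi [M h]].
have [B [B0 hB]] := @continuous_bounded_on_box phi M (nice_continuous nphi).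
exists M, B; have h0 x : ~ box M x -> phi x = 0.
  by move=> nb; apply: contra_notP nb => /eqP; exact: h.
split => // x; have [/hB//|/h0 ->] := pselect (box M x).
by rewrite normr0.
Qed.

Lemma htest_mul phi psi : htest phi -> nice psi -> htest (psi * phi).
Proof.
move=> [nphi [M h]] npsi; split; first exact: nice_mul.
by exists M => x; rewrite fctE mulf_eq0 negb_or => /andP[_]; exact: h.
Qed.

Lemma htest_add phi psi : htest phi -> htest psi -> htest (phi + psi).
Proof.
move=> [n1 [M1 h1]] [n2 [M2 h2]]; split; first exact: nice_add.
have le_box M M' : M <= M' -> box M `<=` box M'.
  by move=> le x [b1 b2]; split => [i|]; [apply: le_trans (b1 i) le|apply: le_trans b2 le].
exists (Num.max M1 M2) => x; rewrite fctE.
have [->|/h1 b1 _] := eqVneq (phi x) 0.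
  by rewrite add0r => /h2; apply: le_box; rewrite le_max lexx orbT.
by apply: le_box b1; rewrite le_max lexx.
Qed.

Lemma htest_D phi v : htest phi -> htest ('D_v phi).
Proof.
move=> [nphi [M h]]; split; first exact: nice_D.
exists M => x; apply: contraNP => nb; apply/eqP.
rewrite (@near_eq_derive _ _ _ phi (cst 0)) ?derive_cst//.
have : open_nbhs x (~` box M).
  by split => //; exact/closed_openC/closed_box.
move=> /open_nbhs_nbhs; apply: filterS => y nby /=.
by apply: contra_notP nby => /eqP; exact: h.
Qed.

(** Linearity in the direction identifies [X_i phi] with the derivative along the
line that the flow follows. *)
Lemma hX_direction i phi x : nice phi ->
  hX i phi x = 'D_((delta_mx ord0 i, hcoef i x.1) : H) phi x.
Proof.
move=> nphi.
have -> : (delta_mx ord0 i, hcoef i x.1) = hcoef i x.1 *: ((0, 1) : H) + (delta_mx ord0 i, 0).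
  by congr pair; rewrite /= ?scaler0 ?add0r// addr0 [RHS]mulr1.
rewrite nice_D_linear// /hX /hcoef /partial_z /partial_t.
by case: fintype.split => j; rewrite addrC// mulNr.
Qed.

Let hXE i phi : hX i phi = 'D_((delta_mx ord0 i, 0) : H) phi
  + (fun x => hcoef i x.1) * 'D_((0, 1) : H) phi.
Proof.
apply/funext => x; rewrite !fctE /hX /hcoef /partial_z /partial_t.
by case: fintype.split => j; rewrite // mulNr.
Qed.

Lemma nice_hcoef i : nice (fun x : H => hcoef i x.1).
Proof.
have [a Ea] := @linform_coef R n i.
rewrite (_ : (fun x => _) = (fun x => linform a 0 x + 0)); first exact: nice_affine.
by apply/funext => x; rewrite addr0 Ea.
Qed.

Lemma nice_hX i phi : nice phi -> nice (hX i phi).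
Proof.
move=> nphi; rewrite hXE; apply: nice_add; first exact: nice_D.
by apply: nice_mul; [exact: nice_hcoef|exact: nice_D].
Qed.

Lemma htest_hX i phi : htest phi -> htest (hX i phi).
Proof.
move=> hphi; rewrite hXE; apply: htest_add; first exact: htest_D.
by apply: htest_mul; [exact: htest_D|exact: nice_hcoef].
Qed.

Lemma hflow_line i r x :
  hflow i r x = x + r *: ((delta_mx ord0 i, hcoef i x.1) : H).
Proof. by []. Qed.

Lemma htest_hflow i r phi : htest phi -> htest (fun x => phi (hflow i r x)).
Proof.
move=> [nphi [M h]]; split; first exact: (nice_comp (@nice_map_hflow R n i r) nphi).
exists (M + `|- r| + `|- r| * M) => x /h /(box_hflow i (- r)).
by rewrite hflow_add addNr hflow0.
Qed.

Lemma htest_vshift s phi : htest phi -> htest (fun x => phi (vshift s x)).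
Proof.
move=> [nphi [M h]]; split; first exact: (nice_comp (@nice_map_vshift R n s) nphi).
exists (M + `|- s|) => x /h /(box_vshift (- s)).
by rewrite vshift_add addNr /vshift addr0; case: x.
Qed.

(** A field commutes with its own flow, because [hcoef i] is constant along it. *)
Lemma hX_hflow i r phi x : nice phi ->
  hX i (fun x => phi (hflow i r x)) x = hX i phi (hflow i r x).
Proof.
move=> nphi; rewrite !hX_direction//; last exact: (nice_comp (@nice_map_hflow R n i r) nphi).
rewrite /= hcoef_flow; apply: eq_derive_along_line => h; congr phi.
rewrite [h *: _ + x]addrC -hflow_line hflow_add addrC -hflow_add hflow_line addrC.
by rewrite /= hcoef_flow.
Qed.

(** Left-invariant fields commute with the centre. *)
Lemma hX_vshift i s phi x : nice phi ->
  hX i (fun x => phi (vshift s x)) x = hX i phi (vshift s x).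
Proof.
move=> nphi; rewrite !hX_direction//; last exact: (nice_comp (@nice_map_vshift R n s) nphi).
apply: eq_derive_along_line => h; congr phi.
by rewrite /vshift /=; congr pair; rewrite addrA.
Qed.

Lemma line_continuous y w : continuous (fun u : R => y + u *: w).
Proof.
move=> u; apply: cvgD; first exact: cvg_cst.
by apply: cvgZr_tmp; exact: cvg_id.
Qed.

Lemma hflow_continuous (i : 'I_(n + n)) (y : H) : continuous (fun u : R => hflow i u y).
Proof.
rewrite (_ : (fun u : R => _) =
  (fun u : R => y + u *: ((delta_mx ord0 i, hcoef i y.1) : H))).
  exact: line_continuous.
by apply/funext => u; rewrite hflow_line.
Qed.

Lemma nice_hflow_continuous (i : 'I_(n + n)) phi (y : H) : nice phi ->
  continuous (fun u : R => phi (hflow i u y)).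
Proof.
move=> nphi u; apply: (@continuous_comp _ _ _ (fun u => hflow i u y) phi).
  exact: hflow_continuous.
exact: nice_continuous.
Qed.

Lemma hflow_FTC (i : 'I_(n + n)) phi (y : H) r : 0 < r -> nice phi ->
  (\int[@lebesgue_measure R]_(u in `[0%R, r]) (hX i phi (hflow i u y))%:E
   = (phi (hflow i r y))%:E - (phi y)%:E)%E.
Proof.
move=> r0 nphi.
have dphi (u : R) : is_derive u (1 : R) (fun u => phi (hflow i u y)) (hX i phi (hflow i u y)).
  rewrite hX_direction// /= hcoef_flow.
  exact: (@is_derive_line R H phi y (delta_mx ord0 i, hcoef i y.1) u
    (@nice_derivable _ _ _ _ _ nphi)).
rewrite (continuous_FTC2 (F := fun u => phi (hflow i u y)) r0) ?hflow0//.
- exact/continuous_subspaceT/nice_hflow_continuous/nice_hX.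
- have cd (u : R) : (fun u : R => phi (hflow i u y)) x @[x --> u] --> phi (hflow i u y).
    apply/differentiable_continuous; rewrite -derivable1_diffP.
    by have [] := dphi u.
  split => [u _||].
  + by have [] := dphi u.
  + by apply: cvg_at_right_filter; exact: cd.
  + by apply: cvg_at_left_filter; exact: cd.
- by move=> u _; rewrite derive1E; have [_] := dphi u.
Qed.

End box.

(** * Test functions separate L^p *)

Section local_integrability.
Context {R : realType} (n : nat).
Local Notation H := ('rV[R]_(n + n) * measurableTypeR R)%type.
Local Notation mu := (lebesgue_heis R n).
Implicit Types (f phi psi w : H -> R).

Lemma powR_ge_base (p y : R) : 1 <= p -> 0 <= y -> y <= 1 + y `^ p.
Proof.
move=> p1 y0; have [y1|/ltW y1] := leP y 1.
  by rewrite (le_trans y1)// lerDl powR_ge0.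
by rewrite (le_trans (le1r_powR y1 p1))// lerDr.
Qed.

(** Domination by [B (1 + |f|^p)] on the box. *)
Lemma Lfun_mul_integrable p f psi M B : 1 <= p -> f \in Lfun mu p%:E ->
  measurable_fun setT psi -> (forall x, ~ box M x -> psi x = 0) ->
  (forall x, `|psi x| <= B) ->
  mu.-integrable setT (fun x => (f x * psi x)%:E).
Proof.
move=> p1 Lf mpsi psi0 psiB.
have mf := Lfun_measurable Lf.
have B0 : 0 <= B by apply: le_trans (psiB point).
have i1 : mu.-integrable setT (fun x => (B%:E * (\1_(box M : set H) x)%:E)%E).
  apply: integrableZl => //; apply/integrableP; split.
    by apply/measurable_EFinP; apply: measurable_indic; exact: measurable_box.
  under eq_integral do rewrite gee0_abs ?lee_fin//.
  by rewrite integral_indic ?setIT//; [exact: lebesgue_box|exact: measurable_box].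
have i2 : mu.-integrable setT (fun x => (B%:E * (`|f x| `^ p)%:E)%E).
  by apply: integrableZl => //; exact: Lfun_integrable.
apply: (le_integrable measurableT _ _ (integrableD measurableT i1 i2)).
  by apply/measurable_EFinP; exact: measurable_funM.
move=> x _; rewrite /= lee_fin normrM.
have f0 := normr_ge0 (f x); have pf0 := powR_ge0 `|f x| p.
have [bx|/psi0 ->] := pselect (box M x); last first.
  by rewrite normr0 mulr0.
rewrite indicE mem_set// mulr1 [leRHS]ger0_norm; last by rewrite addr_ge0 ?mulr_ge0.
rewrite -[X in X + _]mulr1 -mulrDr mulrC; apply: ler_pM => //.
exact: powR_ge_base.
Qed.

Lemma htest_integrable p f phi : 1 <= p -> f \in Lfun mu p%:E -> htest phi ->
  mu.-integrable setT (fun x => (f x * phi x)%:E).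
Proof.
move=> p1 Lf hphi; have [M [B [_ h0 hB]]] := htest_bounded hphi.
by apply: (Lfun_mul_integrable p1 Lf _ h0 hB); apply: nice_measurable; case: hphi.
Qed.

End local_integrability.

Section corners.
Context {R : realType} (n : nat).
Local Notation H := ('rV[R]_(n + n) * measurableTypeR R)%type.
Local Notation mu := (lebesgue_heis R n).

(** Translated open orthants: a pi-system that generates the Borel sets. *)
Definition corner (y : H) : set H :=
  [set x : H | (forall i, (y.1 ord0 i : R) < x.1 ord0 i) /\ (y.2 : R) < x.2].

Definition corners : set (set H) := range corner.

Lemma corners_setI : setI_closed corners.
Proof.
move=> _ _ [y _ <-] [z _ <-].
exists (\row_i Num.max (y.1 ord0 i) (z.1 ord0 i), Num.max (y.2 : R) z.2) => //.
apply/seteqP; split => x /=.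
  by move=> [h1 h2]; split; split => [i|];
    [have := h1 i; rewrite mxE|move: h2|have := h1 i; rewrite mxE|move: h2];
    rewrite gt_max => /andP[].
move=> [[h1 h2] [h3 h4]]; split => [i|]; last by rewrite gt_max h2.
by rewrite mxE gt_max h1 h3.
Qed.

(** It suffices that the coordinates are measurable for the sigma-algebra
generated by the orthants, and a half-space is a countable union of orthants. *)
Lemma measurable_sub_corners : @measurable _ H `<=` <<s corners >>.
Proof.
pose T := g_sigma_algebraType corners.
suff mid : measurable_fun [set: T] (fun x : T => x : H).
  move=> A mA; rewrite -[A]setTI.
  exact: mid measurableT _ mA.
have mc (f : T -> R) (y : R -> nat -> H) :
    (forall a, f @^-1` `]a, +oo[ = \bigcup_k corner (y a k)) ->
    measurable_fun [set: T] (f : T -> measurableTypeR R).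
  move=> fy; apply: (measurability _ (RGenOInfty.measurableE R)) => _ [_ [a ->] <-].
  rewrite setTI fy; apply: bigcupT_measurable => k.
  by apply: sub_sigma_algebra; exists (y a k).
apply/measurable_heisP; split => [i|].
- apply: (mc _ (fun a k => (\row_j (if j == i then a else - k%:R), - k%:R))) => a.
  apply/seteqP; split => x /=.
    rewrite in_itv/= andbT => ax.
    pose M := \sum_j `|x.1 ord0 j| + `|x.2 : R|.
    have M0 : 0 <= M by rewrite addr_ge0// sumr_ge0.
    have lb (b : R) : `|b| <= M -> - (Num.truncn M).+1%:R < b.
      move=> bM; rewrite ltrNl (le_lt_trans (ler_norm _))// normrN.
      by apply: le_lt_trans bM _; have /andP[] := truncn_itv M0.
    exists (Num.truncn M).+1 => //; split => [j|] /=.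
      rewrite mxE; case: eqP => [->//|_]; apply: lb.
      by rewrite /M (bigD1 j)//= -addrA lerDl addr_ge0// sumr_ge0.
    by apply: lb; rewrite lerDr sumr_ge0.
  by move=> [k _ [/(_ i)]]; rewrite /= mxE eqxx in_itv/= andbT.
- apply: (mc _ (fun a k => (\row_j (- k%:R), a))) => a.
  apply/seteqP; split => x /=.
    rewrite in_itv/= andbT => ax.
    pose M := \sum_j `|x.1 ord0 j|.
    have M0 : 0 <= M by rewrite sumr_ge0.
    exists (Num.truncn M).+1 => //; split => //= j.
    rewrite mxE ltrNl (le_lt_trans (ler_norm _))// normrN.
    have : `|x.1 ord0 j| <= M by rewrite /M (bigD1 j)//= lerDl sumr_ge0.
    by move=> bM; apply: le_lt_trans bM _; have /andP[] := truncn_itv M0.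
  by move=> [k _ [_ /=]]; rewrite in_itv/= andbT.
Qed.

Lemma bump0_gt0 (s : R) : (0 < bump 0 s) = (0 < s).
Proof. by rewrite /bump; case: ifPn => [_|]; rewrite ?ltxx// mul1r expR_gt0. Qed.

Lemma bump0_le1 (s : R) : bump 0 s <= 1.
Proof.
rewrite /bump; case: ifPn => // s0; rewrite mul1r -expR0 ler_expR oppr_le0.
by rewrite invr_ge0 ltW.
Qed.

Lemma bump0_cvg (s : R) :
  (fun k : nat => bump 0 ((k.+1%:R : R) * s)) @ \oo --> ((0 < s)%R%:R : R).
Proof.
case: (boolP (0 < s)) => [s0|]; last rewrite -leNgt => s0.
  rewrite (_ : (fun k : nat => _) = (fun k : nat => expR (- (s^-1 * k.+1%:R^-1)))); last first.
    by apply/funext => k; rewrite /bump pmulr_rgt0// s0 mul1r invfM mulrC.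
  rewrite [X in _ --> X](_ : _ = expR (- 0)); last by rewrite oppr0 expR0.
  apply: continuous_cvg; first exact: continuous_expR.
  apply: cvgN; rewrite -[X in _ --> X](mulr0 s^-1); apply: cvgMl_tmp.
  exact: (@cvg_harmonic R).
rewrite (_ : (fun k : nat => _) = cst 0); first exact: cvg_cst.
by apply/funext => k; rewrite /bump ltNge pmulr_rle0 ?s0.
Qed.

(** As [k] grows these nice functions increase to the indicator of the orthant,
because [bump 0 (k s) = exp (- 1 / (k s))] tends to [1] for [0 < s]. *)
Definition orthant_cutoff (k : R) (y : H) (x : H) : R :=
  \prod_i bump 0 (k * (x.1 ord0 i - y.1 ord0 i)) * bump 0 (k * (x.2 - y.2 : R)).

Lemma nice_orthant_cutoff k y : nice (orthant_cutoff k y).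
Proof.
rewrite /orthant_cutoff.
have E : (fun x : H => \prod_i bump 0 (k * (x.1 ord0 i - y.1 ord0 i))
       * bump 0 (k * (x.2 - y.2 : R)))
  = (\prod_i (fun x : H => bump 0 (linform (k *: delta_mx ord0 i) 0 x - k * y.1 ord0 i)))
    * (fun x => bump 0 (linform 0 k x - k * y.2)).
  apply/funext => x; rewrite fctE (big_morph (fun f : H -> R => f x)
    (id1 := 1) (op1 := *%R))//; congr (_ * bump 0 _).
    apply: eq_bigr => i _; congr bump; rewrite /linform mul0r addr0 (bigD1 i)//=.
    rewrite !mxE !eqxx mulr1 big1 ?addr0 ?mulrBr// => j ji.
    by rewrite !mxE eqxx (negbTE ji) mulr0 mul0r.
  rewrite /linform big1 ?add0r ?mulrBr// => j _.
  by rewrite mxE mul0r.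
rewrite E; apply: nice_mul; last exact: nice_bump.
apply: (big_ind (@nice R n)); first exact: nice_cst.
  by move=> f g; exact: nice_mul.
by move=> i _; exact: nice_bump.
Qed.

Lemma orthant_cutoff_itv k y x : 0 <= orthant_cutoff k y x <= 1.
Proof.
have p0 : 0 <= \prod_i bump 0 (k * (x.1 ord0 i - y.1 ord0 i)) <= 1.
  elim/big_ind : _; first by rewrite ler01 lexx.
    by move=> a b /andP[a0 a1] /andP[b0 b1]; rewrite mulr_ge0// mulr_ile1.
  by move=> i _; rewrite bump_ge0 bump0_le1.
have /andP[h0 h1] := p0.
by rewrite mulr_ge0 ?bump_ge0// mulr_ile1// ?bump_ge0// bump0_le1.
Qed.

Lemma orthant_cutoff_cvg y x :
  (fun k : nat => orthant_cutoff k.+1%:R y x) @ \oo --> (\1_(corner y) x : R).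
Proof.
have -> : \1_(corner y) x =
    \prod_i (0 < x.1 ord0 i - y.1 ord0 i)%R%:R * (0 < (x.2 - y.2 : R))%R%:R :> R.
  rewrite indicE; have [[h1 h2]|nc] := asboolP (corner y x).
    rewrite mem_set; last by [].
    rewrite subr_gt0 h2 mulr1 big1// => i _; by rewrite subr_gt0 h1.
  rewrite memNset//; apply/esym/eqP.
  apply: contra_notT nc; rewrite mulf_eq0 negb_or => /andP[/prodf_neq0 h].
  rewrite pnatr_eq0 eqb0 negbK subr_gt0 => h2; split => // i.
  by have := h i isT; rewrite pnatr_eq0 eqb0 negbK subr_gt0.
apply: cvgM; last exact: bump0_cvg.
apply: cvg_big => [|i _]; first exact: mul_continuous.
exact: bump0_cvg.
Qed.

Lemma measurable_corner y : measurable (corner y).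
Proof.
have E : corner y = orthant_cutoff 1 y @^-1` `]0, +oo[%classic.
  apply/seteqP; split => x /=; rewrite in_itv/= andbT.
    move=> [h1 h2]; rewrite /orthant_cutoff; apply: mulr_gt0.
      by apply: prodr_gt0 => i _; rewrite bump0_gt0 mul1r subr_gt0.
    by rewrite bump0_gt0 mul1r subr_gt0.
  rewrite /orthant_cutoff lt_neqAle eq_sym mulf_eq0 negb_or => /andP[/andP[h1 h2] _].
  have pos (s : R) : bump 0 s != 0 -> 0 < s.
    by move=> sN0; rewrite -bump0_gt0 lt_neqAle eq_sym sN0 bump_ge0.
  split => [i|]; last by move: h2 => /pos; rewrite mul1r subr_gt0.
  by move: h1 => /prodf_neq0/(_ i isT)/pos; rewrite mul1r subr_gt0.
rewrite E -[X in measurable X]setTI.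
by apply: (nice_measurable (nice_orthant_cutoff 1 y)).
Qed.

(** Dynkin's pi-lambda theorem for the charge of density [v]. *)
Lemma ae_eq0_corners (v : H -> R) : mu.-integrable setT (EFin \o v) ->
  (\int[mu]_x (v x)%:E = 0)%E ->
  (forall y, (\int[mu]_(x in corner y) (v x)%:E = 0)%E) ->
  ae_eq mu setT (EFin \o v) (cst 0%E).
Proof.
move=> iv v0 vc.
pose nu := induced_charge iv.
pose D := [set A : set H | measurable A /\ nu A = 0%E].
have dD : dynkin D.
  split.
  - by split => //; rewrite /nu /induced_charge.
  - move=> A [mA A0]; have mC := measurableC mA; split => //.
    have e : nu setT = (nu A + nu (~` A))%E.
      by rewrite -(setUCr A); exact: (@chargeU _ _ _ nu A (~` A) mA mC (setICr A)).
    by move: e; rewrite A0 add0e => <-.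
  - move=> F tF DF; split; first by apply: bigcupT_measurable => i; exact: (DF i).1.
    have mF i : measurable (F i) by exact: (DF i).1.
    have c1 : (fun k => \sum_(0 <= i < k) nu (F i))%E @ \oo --> nu (\bigcup_k F k).
      exact: (@charge_semi_sigma_additive _ _ R nu F mF tF (bigcupT_measurable F mF)).
    have c0 : (fun k => \sum_(0 <= i < k) nu (F i))%E @ \oo --> 0%E.
      rewrite (_ : (fun k => _) = cst 0%E); first exact: cvg_cst.
      by apply/funext => k; rewrite big1// => i _; exact: (DF i).2.
    by apply: cvg_unique c1 c0; exact: ereal_hausdorff.
apply: integral_ae_eq => // A _ mA.
rewrite integral0.
have : <<s corners >> A by exact: measurable_sub_corners.
rewrite -setI_closed_g_dynkin_g_sigma_algebra; last exact: corners_setI.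
have cD : corners `<=` D by move=> _ [y _ <-]; split; [exact: measurable_corner|exact: vc].
by move=> /(_ _ (conj dD cD))[].
Qed.

End corners.

Section fundamental.
Context {R : realType} (n : nat).
Local Notation H := ('rV[R]_(n + n) * measurableTypeR R)%type.
Local Notation mu := (lebesgue_heis R n).
Implicit Types (f phi psi w : H -> R).

Lemma orthant_cutoff_neq0 (k : R) (y x : H) : orthant_cutoff k y x != 0 <->
  (forall i, 0 < k * (x.1 ord0 i - y.1 ord0 i)) /\ 0 < k * (x.2 - y.2 : R).
Proof.
have pos (s : R) : (bump 0 s != 0) = (0 < s).
  by rewrite -bump0_gt0 [RHS]lt_neqAle eq_sym bump_ge0 andbT.
rewrite /orthant_cutoff mulf_eq0 negb_or pos; split => [/andP[h1 h2]|[h1 h2]].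
  by split => // i; rewrite -pos; move: h1 => /prodf_neq0; apply.
by rewrite h2 andbT; apply/prodf_neq0 => i _; rewrite pos.
Qed.

(** A test function that is positive exactly on an open box. *)
Definition box_cutoff (M : R) : H -> R :=
  orthant_cutoff 1 (const_mx (- M), - M) * orthant_cutoff (-1) (const_mx M, M).

Lemma box_cutoff_neq0 M x : box_cutoff M x != 0 <->
  (forall i, `|x.1 ord0 i| < M) /\ `|x.2 : R| < M.
Proof.
rewrite /box_cutoff fctE mulf_eq0 negb_or; split.
  move=> /andP[/orthant_cutoff_neq0[/= h1 h2] /orthant_cutoff_neq0[/= h3 h4]].
  split => [i|]; rewrite ltr_norml.
    by have := h1 i; have := h3 i; rewrite !mxE; lra.
  lra.
move=> [h1 h2]; apply/andP; split; apply/orthant_cutoff_neq0; split => [i|] /=.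
- by have := h1 i; rewrite mxE ltr_norml; lra.
- by move: h2; rewrite ltr_norml; lra.
- by have := h1 i; rewrite mxE ltr_norml; lra.
- by move: h2; rewrite ltr_norml; lra.
Qed.

Lemma htest_box_cutoff M : htest (box_cutoff M).
Proof.
split; first by apply: nice_mul; exact: nice_orthant_cutoff.
by exists M => x /box_cutoff_neq0[h1 h2]; split => [i|]; exact: ltW.
Qed.

(** A cutoff makes [w] integrable; then its integrals over all orthants vanish,
as limits of integrals against test functions. *)
Lemma Lp_norm_eq0_htest p w : 1 <= p -> w \in Lfun mu p%:E ->
  (forall phi, htest phi -> \int[mu]_x (w x * phi x) = 0) -> Lp_norm mu p w = 0.
Proof.
move=> p1 Lw w0; have mw := Lfun_measurable Lw.
have w0E phi : htest phi -> (\int[mu]_x (w x * phi x)%:E = 0)%E.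
  move=> hphi; have := w0 _ hphi; rewrite /Rintegral => wz.
  rewrite -[LHS]fineK ?wz//.
  exact: (integrable_fin_num measurableT (htest_integrable p1 Lw hphi)).
have ae_k (k : nat) : ae_eq mu setT (EFin \o (w * box_cutoff k.+1%:R)) (cst 0%E).
  set om := box_cutoff _; have hom : htest om := htest_box_cutoff _.
  have iv := htest_integrable p1 Lw hom.
  apply: ae_eq0_corners => // [|y]; first exact: w0E.
  pose g (j : nat) x := (w x * om x * orthant_cutoff j.+1%:R y x)%:E.
  have mom : measurable_fun setT om by apply: nice_measurable; case: hom.
  have g0 j : (\int[mu]_x g j x = 0)%E.
    rewrite -[RHS](w0E (orthant_cutoff j.+1%:R y * om)).
      by apply: eq_integral => x _; rewrite /g fctE -mulrA [om x * _]mulrC.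
    by apply: htest_mul => //; exact: nice_orthant_cutoff.
  have [|||||_ _] := @dominated_convergence _ _ R mu setT measurableT g
    (fun x => (w x * om x * \1_(corner y) x)%:E) (fun x => `|(w x * om x)%:E|%E).
  - move=> j; apply/measurable_EFinP; apply: measurable_funM.
      exact: measurable_funM.
    exact: (nice_measurable (nice_orthant_cutoff _ _)).
  - apply/measurable_EFinP; apply: measurable_funM; first exact: measurable_funM.
    by apply: measurable_indic; exact: measurable_corner.
  - apply: aeW => x _; apply: cvg_EFin; first exact: nearW.
    by apply: cvgMl_tmp; exact: orthant_cutoff_cvg.
  - exact: integrable_abse.
  - apply: aeW => x j _; rewrite lee_fin normrM ler_piMr//.
    by have /andP[c0 c1] := orthant_cutoff_itv j.+1%:R y x; rewrite ger0_norm.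
  rewrite (_ : [sequence _]_j = cst 0%E); last exact/funext.
  move=> c1; have e := cvg_unique (@ereal_hausdorff R) c1 (cvg_cst _).
  rewrite -[RHS]e [LHS]integral_mkcond; apply: eq_integral => x _.
  rewrite patchE indicE; case: ifPn => _; first by rewrite mulr1.
  by rewrite mulr0.
have ae0 : ae_eq mu setT (fun x => (`|w x| `^ p)%:E) (cst 0%E).
  have neg : mu.-negligible (\bigcup_k [set x | w x * box_cutoff k.+1%:R x != 0]).
    apply: negligible_bigcup => k; move: (ae_k k); apply: negligibleS => x /=.
    by move=> /eqP h; apply/not_implyP; split => //; apply: contra_not h => -[].
  move: neg; apply: negligibleS => x /= /not_implyP[_ wx].
  have wN0 : w x != 0.
    apply: contra_notN wx => /eqP ->; rewrite normr0 powR0//.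
    by rewrite gt_eqF// (lt_le_trans ltr01).
  pose M := \sum_j `|x.1 ord0 j| + `|x.2 : R|.
  have M0 : 0 <= M by rewrite addr_ge0// sumr_ge0.
  have lb (b : R) : `|b| <= M -> `|b| < (Num.truncn M).+1%:R.
    by move=> bM; apply: le_lt_trans bM _; have /andP[] := truncn_itv M0.
  exists (Num.truncn M) => //=; rewrite mulf_neq0//.
  apply/box_cutoff_neq0; split => [i|]; apply: lb.
    by rewrite /M (bigD1 i)//= -addrA lerDl addr_ge0// sumr_ge0.
  by rewrite lerDr sumr_ge0.
apply/eqP; rewrite eq_le Lp_norm_ge0 andbT; apply: Lp_norm_le => //.
rewrite powR0; last by rewrite gt_eqF// (lt_le_trans ltr01).
rewrite (ae_eq_integral (cst 0%E)) ?integral0//.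
by apply/measurable_EFinP; exact: measurable_powR_norm.
Qed.

End fundamental.

(** * Integrating a family of functions over an interval of parameters *)

Section average.
Context d (T : measurableType d) {R : realType}.
Variable mu : {sigma_finite_measure set T -> \bar R}.
Variables (p r : R) (g : measurableTypeR R * T -> R) (N : R).
Hypotheses (p1 : 1 < p) (r0 : 0 < r) (mg : measurable_fun setT g) (N0 : 0 <= N).
Hypothesis gN : forall u, (\int[mu]_x (`|g (u, x)| `^ p)%:E <= (N `^ p)%:E)%E.
Local Notation leb := (@lebesgue_measure R).

Let I (u : R) : R := \1_(`[0, r]%classic : set R) u.
Let G (ux : measurableTypeR R * T) := I ux.1 * g ux.

Let p0 : 0 < p. Proof. exact: lt_trans p1. Qed.

Let mI : measurable_fun setT (I : measurableTypeR R -> R).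
Proof. by apply: measurable_indic; exact: measurable_itv. Qed.

Let mG : measurable_fun setT G.
Proof.
apply: measurable_funM => //.
exact: (measurableT_comp mI measurable_fst).
Qed.

Definition interval_integral (x : T) : R := \int[leb]_u (I u * g (u, x)).

Lemma measurable_interval_integral : measurable_fun setT interval_integral.
Proof.
rewrite /interval_integral /Rintegral.
apply: measurableT_comp => //.
have mGE : measurable_fun setT (EFin \o G) by exact/measurable_EFinP.
rewrite (_ : (fun x => _) = (fun x => \int[leb]_u (EFin \o G)^\+ (u, x)
   - \int[leb]_u (EFin \o G)^\- (u, x))%E).
  apply: emeasurable_funB.
    apply: (measurable_fun_fubini_tonelli_G (m1 := leb) (EFin \o G)^\+%E) => //.
    exact: measurable_funepos.
  apply: (measurable_fun_fubini_tonelli_G (m1 := leb) (EFin \o G)^\-%E) => //.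
  exact: measurable_funeneg.
apply/funext => x; rewrite [LHS]integralE.
by congr (_ - _)%E; apply: eq_integral => u _; rewrite ?funeposE ?funenegE.
Qed.

Let integral_I : (\int[leb]_u (I u)%:E = r%:E)%E.
Proof.
have e : @lebesgue_measure R `[0%R, r]%classic = r%:E.
  by rewrite lebesgue_measure_itv/= lte_fin r0 sube0.
by rewrite integral_indic// setIT.
Qed.

Let hoelder_interval x : ((`|interval_integral x| `^ p)%:E <=
  (r `^ (p - 1))%:E * \int[leb]_u (`|G (u, x)| `^ p)%:E)%E.
Proof.
have mGx : measurable_fun setT (fun u : measurableTypeR R => G (u, x)).
  exact: (measurable_fun_pair1 _ mG).
have le1 : ((`|interval_integral x|)%:E <= \int[leb]_u (`|G (u, x)|)%:E)%E.
  apply: (@le_trans _ _ `| \int[leb]_u (G (u, x))%:E |%E).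
    rewrite /interval_integral /Rintegral.
    by case: (\int[_]_u _)%E => [s| |]//=; rewrite normr0 leey.
  apply: le_trans (le_abse_integral leb measurableT _) _ => //.
  exact/measurable_EFinP.
have pm0 : 0 < p - 1 by rewrite subr_gt0.
pose q := p / (p - 1).
have q0 : 0 < q by rewrite divr_gt0.
have pq : p^-1 + q^-1 = 1.
  by rewrite /q invf_div -{1}(div1r p) -mulrDl subrKC mulfV// gt_eqF.
have := @hoelder _ _ _ leb (fun u => G (u, x)) I p q mGx mI p0 q0 pq.
have -> : ('N[leb]_1[EFin \o ((fun u : R => G (u, x)) \* I)%R] =
   \int[leb]_u (`|G (u, x)|)%:E)%E.
  rewrite Lnorm1; apply: eq_integral => u _ /=; rewrite /G/= mulrAC -expr2.
  by rewrite /I indicE; case: (_ \in _); rewrite ?expr1n ?expr0n.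
have -> : ('N[leb]_q%:E[EFin \o I] = (r `^ q^-1)%:E)%E.
  rewrite unlock -poweR_EFin -integral_I; congr (_ `^ _)%E.
  apply: eq_integral => u _ /=; rewrite ?poweR_EFin /I indicE.
  by case: (_ \in _); rewrite ?normr1 ?powR1// normr0 powR0// gt_eqF.
move=> /(le_trans le1) le2.
have := gt0_ler_poweR (ltW p0) _ _ le2.
rewrite !in_itv/= !leey !andbT lee_fin normr_ge0 mule_ge0 ?Lnorm_ge0 ?lee_fin ?powR_ge0//.
move=> /(_ isT isT); rewrite ?poweR_EFin poweRM ?Lnorm_ge0 ?lee_fin ?powR_ge0//.
rewrite poweR_Lnorm ?gt_eqF// poweR_EFin -powRrM.
rewrite (_ : q^-1 * p = p - 1); last first.
  by rewrite /q invf_div divfK// gt_eqF.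
by rewrite muleC.
Qed.

(** Hoelder in the parameter and Tonelli. The section uses an indicator instead of
a restricted domain of integration so that Tonelli applies on the product. *)
Lemma interval_integral_Lp : interval_integral \in Lfun mu p%:E /\
  Lp_norm mu p interval_integral <= r * N.
Proof.
have mGp : measurable_fun setT (fun ux => (`|G ux| `^ p)%:E).
  by apply/measurable_EFinP; exact: measurable_powR_norm.
have le : (\int[mu]_x (`|interval_integral x| `^ p)%:E <= ((r * N) `^ p)%:E)%E.
  apply: (@le_trans _ _ (\int[mu]_x
      ((r `^ (p - 1))%:E * \int[leb]_u (`|G (u, x)| `^ p)%:E))%E).
    apply: ge0_le_integral => //.
    - by apply/measurable_EFinP; apply: measurable_powR_norm; exact: measurable_interval_integral.
    - apply: measurable_funeM.
      exact: (measurable_fun_fubini_tonelli_G (m1 := leb) (fun ux => (`|G ux| `^ p)%:E)).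
  rewrite ge0_integralZl_EFin ?powR_ge0//; last 2 first.
  - by move=> x _; apply: integral_ge0 => u _; rewrite lee_fin powR_ge0.
  - exact: (measurable_fun_fubini_tonelli_G (m1 := leb) (fun ux => (`|G ux| `^ p)%:E)).
  rewrite -(fubini_tonelli (fun ux => (`|G ux| `^ p)%:E))//.
  apply: (@le_trans _ _ ((r `^ (p - 1))%:E * \int[leb]_u ((N `^ p)%:E * (I u)%:E))%E).
    rewrite lee_wpmul2l ?lee_fin ?powR_ge0//; apply: ge0_le_integral => //.
    - by move=> u _; apply: integral_ge0 => x _; rewrite lee_fin powR_ge0.
    - exact: (measurable_fun_fubini_tonelli_F (m2 := mu) (fun ux => (`|G ux| `^ p)%:E)).
    - by apply: measurable_funeM; exact/measurable_EFinP.
    - move=> u _; rewrite /G /I indicE /=; case: (_ \in _); last first.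
        rewrite mule0 (eq_integral (cst 0%E)) ?integral0// => x _.
        by rewrite mul0r normr0 powR0// gt_eqF.
      by rewrite mule1; under eq_integral do rewrite mul1r.
  rewrite ge0_integralZl_EFin ?powR_ge0//; last 2 first.
  - by move=> u _; rewrite lee_fin /I indicE.
  - exact/measurable_EFinP.
  rewrite integral_I -!EFinM lee_fin mulrCA -[r `^ _ * r]mulrC mulr_powRB1 ?(ltW r0)//.
  by rewrite -powRM ?(ltW r0)// mulrC.
have L : interval_integral \in Lfun mu p%:E.
  apply: Lfun_finite; first exact: measurable_interval_integral.
  by apply: le_lt_trans le _; rewrite ltry.
by split => //; apply: Lp_norm_le => //; [exact: ltW|rewrite mulr_ge0// ltW].
Qed.

End average.

(** * Weak derivatives control translations along horizontal lines *)

Section horizontal.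
Context {R : realType} (n : nat).
Local Notation H := ('rV[R]_(n + n) * measurableTypeR R)%type.
Local Notation mu := (lebesgue_heis R n).
Local Notation leb := (@lebesgue_measure R).
Implicit Types (f g h phi psi : H -> R) (i : 'I_(n + n)).

Lemma sigma_finite_lebesgue_heis : sigma_finite setT mu.
Proof.
exists (fun k : nat => box k%:R); last first.
  by move=> k; split; [exact: measurable_box|exact: lebesgue_box].
apply/esym; rewrite -subTset => x _.
pose M := \sum_j `|x.1 ord0 j| + `|x.2 : R|.
have M0 : 0 <= M by rewrite addr_ge0// sumr_ge0.
have lb (b : R) : `|b| <= M -> `|b| <= (Num.truncn M).+1%:R.
  by move=> bM; apply/ltW/(le_lt_trans bM); have /andP[] := truncn_itv M0.
exists (Num.truncn M).+1 => //; split => [i|]; apply: lb.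
  by rewrite /M (bigD1 i)//= -addrA lerDl addr_ge0// sumr_ge0.
by rewrite lerDr sumr_ge0.
Qed.

(** The same measure, with the structure that Fubini's theorem requires. *)
Definition lebesgue_heis_sf : {sigma_finite_measure set H -> \bar R} :=
  HB.pack_for {sigma_finite_measure set H -> \bar R} (Measure.sort mu)
   (Measure_isSigmaFinite.Build _ _ _ mu sigma_finite_lebesgue_heis).
Local Notation muS := lebesgue_heis_sf.

(** The weak derivative tested on nice functions only, so that every integrand is
measurable and integrable. *)
Definition htest_weak i f g := forall phi, htest phi ->
  (\int[mu]_x (f x * hX i phi x)%:E = - \int[mu]_x (g x * phi x)%:E)%E.

Variable p : R.
Hypothesis p1 : 1 < p.
Let p1' : 1 <= p. Proof. exact: ltW. Qed.

Lemma is_weak_hX_htest i f g : f \in Lfun mu p%:E -> g \in Lfun mu p%:E ->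
  is_weak_hX i f g -> htest_weak i f g.
Proof.
move=> Lf Lg w phi hphi; have := w phi (htest_test_function hphi).
have if1 := integrable_fin_num measurableT (htest_integrable p1' Lf (htest_hX i hphi)).
have if2 := integrable_fin_num measurableT (htest_integrable p1' Lg hphi).
by rewrite /Rintegral => e; rewrite -(fineK if1) -(fineK if2) e EFinN.
Qed.

Lemma htest_weak_lin i a f g f' g' :
  f \in Lfun mu p%:E -> g \in Lfun mu p%:E ->
  f' \in Lfun mu p%:E -> g' \in Lfun mu p%:E ->
  htest_weak i f g -> htest_weak i f' g' -> htest_weak i (a *: f + f') (a *: g + g').
Proof.
move=> Lf Lg Lf' Lg' w w' phi hphi.
have split_int (u v : H -> R) (psi : H -> R) : u \in Lfun mu p%:E ->
    v \in Lfun mu p%:E -> htest psi ->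
    (\int[mu]_x ((a *: u + v) x * psi x)%:E
    = a%:E * \int[mu]_x (u x * psi x)%:E + \int[mu]_x (v x * psi x)%:E)%E.
  move=> Lu Lv hpsi.
  have iu := htest_integrable p1' Lu hpsi; have iv := htest_integrable p1' Lv hpsi.
  rewrite -integralZl// -integralD//; last exact: integrableZl.
  by apply: eq_integral => x _; rewrite -EFinM -EFinD !fctE /GRing.scale/= mulrDl mulrA.
rewrite !split_int//; last exact: htest_hX.
have fin := integrable_fin_num measurableT (htest_integrable p1' Lg' hphi).
rewrite (w _ hphi) (w' _ hphi) muleN; apply/esym.
by apply: fin_num_oppeD; exact: fin.
Qed.

Lemma htest_weak_vshift i s f g : f \in Lfun mu p%:E -> g \in Lfun mu p%:E ->
  htest_weak i f g ->
  htest_weak i (fun x => f (vshift s x)) (fun x => g (vshift s x)).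
Proof.
move=> Lf Lg w phi hphi.
have vK x : vshift (- s) (vshift s x) = x.
  by rewrite vshift_add addNr /vshift addr0; case: x.
pose psi x := phi (vshift (- s) x).
have hpsi : htest psi by exact: htest_vshift.
have mm h chi : h \in Lfun mu p%:E -> htest chi ->
    measurable_fun setT (fun x => (h x * chi x)%:E).
  move=> Lh [nchi _]; apply/measurable_EFinP; apply: measurable_funM.
    exact: Lfun_measurable Lh.
  exact: nice_measurable.
rewrite [RHS](_ : _ = (- \int[mu]_x (g x * psi x)%:E)%E); last first.
  rewrite -(integral_preserving (@vshift_preserving R n s) (mm _ _ Lg hpsi)).
  by congr (- _)%E; apply: eq_integral => x _; rewrite /psi vK.
rewrite -(w _ hpsi).
rewrite -(integral_preserving (@vshift_preserving R n s) (mm _ _ Lf (htest_hX i hpsi))).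
apply: eq_integral => x _; rewrite /psi hX_vshift ?vK//.
by have [] := hphi.
Qed.

Variables (i : 'I_(n + n)) (r : R).
Hypothesis r0 : 0 < r.

Let I (u : R) : R := \1_(`[0, r]%classic : set R) u.

Let mI : measurable_fun setT (I : measurableTypeR R -> R).
Proof. by apply: measurable_indic; exact: measurable_itv. Qed.

Let integral_I (c : R) : 0 <= c ->
  (\int[leb]_u (I u * c)%:E < +oo)%E.
Proof.
move=> c0; under eq_integral do rewrite EFinM.
have mIE : measurable_fun setT (fun u : measurableTypeR R => (I u)%:E).
  by apply/measurable_EFinP.
have I0 u : (0 <= (I u)%:E)%E by rewrite lee_fin /I indicE.
rewrite ge0_integralZr//.
have e : @lebesgue_measure R `[0%R, r]%classic = r%:E.
  by rewrite lebesgue_measure_itv/= lte_fin r0 sube0.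
by rewrite integral_indic// setIT [X in (X * _)%E]e -EFinM ltry.
Qed.

Let mflow (a : measurableTypeR R -> measurableTypeR R) h :
  measurable_fun setT a -> measurable_fun setT h ->
  measurable_fun setT (fun ux : measurableTypeR R * H => h (hflow i (a ux.1) ux.2)).
Proof.
move=> ma mh; apply: (measurableT_comp mh).
apply: (measurableT_comp (measurable_hflow2 i)
  (_ : measurable_fun setT (fun ux : measurableTypeR R * H => (a ux.1, ux.2)))).
apply: measurable_fun_pair => //.
exact: measurableT_comp.
Qed.

(** For [0 <= u <= r] the translates of [psi] are supported in a common box. *)
Let flow_htest_bound h psi : h \in Lfun mu p%:E -> htest psi -> exists c : R, 0 <= c /\
  forall u, 0 <= u <= r ->
  (\int[mu]_x `|(h x * psi (hflow i (u - r) x))%:E| <= c%:E)%E.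
Proof.
move=> Lh hpsi; have [M [B [B0 psi0 psiB]]] := htest_bounded hpsi.
have mpsi : measurable_fun setT psi by apply: nice_measurable; case: hpsi.
pose M' := M + r + r * M.
pose chi x : R := B * \1_(box M' : set H) x.
have ichi : mu.-integrable setT (fun x => (h x * chi x)%:E).
  apply: (@Lfun_mul_integrable _ _ p h chi M' B) => //.
  - by apply: measurable_funM => //; apply: measurable_indic; exact: measurable_box.
  - by move=> x bx; rewrite /chi indicE memNset ?mulr0.
  - move=> x; rewrite /chi indicE normrM ger0_norm// ler_piMr//.
    by case: (_ \in _); rewrite ?normr1 ?normr0.
have fin := integrable_fin_num measurableT (integrable_abse ichi).
exists (fine (\int[mu]_x `|(h x * chi x)%:E|)); split.
  by apply: fine_ge0; apply: integral_ge0.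
move=> u /andP[u0 ur]; rewrite fineK//; apply: ge0_le_integral => //.
- apply: measurableT_comp => //; apply/measurable_EFinP; apply: measurable_funM.
    exact: Lfun_measurable Lh.
  by apply: measurableT_comp => //; exact: measurable_hflow.
- by apply: measurableT_comp => //; exact: (measurable_int _ ichi).
move=> x _; rewrite /= lee_fin (normrM _ (chi x)) (normrM _ (psi _)) ler_wpM2l//.
have [bx|/psi0 ->] := pselect (box M (hflow i (u - r) x)); last by rewrite normr0.
have M0 : 0 <= M by case: bx => _; exact: le_trans.
suff bx' : box M' x.
  have -> : `|chi x| = B by rewrite /chi indicE mem_set// mulr1 ger0_norm.
  exact: psiB.
have := box_hflow i (r - u) bx; rewrite hflow_add addrA subrK subrr hflow0.
have e : `|r - u| <= r by rewrite ger0_norm ?subr_ge0// gerBl.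
have : M + `|r - u| + `|r - u| * M <= M'.
  by rewrite /M' lerD ?lerD2l// ler_wpM2r.
by move=> le [b1 b2]; split => [j|]; [apply: le_trans (b1 j) le|apply: le_trans b2 le].
Qed.

Let integrable_flow_htest h psi (F : measurableTypeR R * H -> R) :
  h \in Lfun mu p%:E -> htest psi -> measurable_fun setT F ->
  (forall u, (\int[mu]_x `|(F (u, x))%:E|
     = (I u)%:E * \int[mu]_x `|(h x * psi (hflow i (u - r) x))%:E|)%E) ->
  (leb \x muS)%E.-integrable setT (EFin \o F).
Proof.
move=> Lh hpsi mF FE; have [c [c0 hc]] := flow_htest_bound Lh hpsi.
apply/integrable12ltyP; first exact/measurable_EFinP.
apply: le_lt_trans (integral_I c0); apply: ge0_le_integral => //.
- by move=> u _; apply: integral_ge0.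
- apply: (measurable_fun_fubini_tonelli_F (m2 := muS) (fun ux => `|(F ux)%:E|%E)) => //.
  by apply: measurableT_comp => //; exact/measurable_EFinP.
- by apply/measurable_EFinP; exact: measurable_funM.
move=> u _; apply: le_trans (_ : (\int[mu]_x `|(F (u, x))%:E| <= _)%E) => //.
rewrite FE EFinM /I indicE; case: (boolP (_ \in _)) => [|_]; last by rewrite !mul0e.
by rewrite inE/= in_itv/= !mul1e => /hc.
Qed.

(** Differentiating [phi] along the flow moves the difference of [f] onto the
test function; the weak derivative trades [X_i phi] for [g], and the invariance
of the measure moves the flow back to [g]. *)
Lemma htest_weak_integral f g phi : f \in Lfun mu p%:E -> g \in Lfun mu p%:E ->
  htest_weak i f g -> htest phi ->
  (\int[mu]_x (f (hflow i r x) * phi x)%:E - \int[mu]_x (f x * phi x)%:E =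
   \int[mu]_x (interval_integral r (fun ux => g (hflow i (r - ux.1) ux.2)) x * phi x)%:E)%E.
Proof.
move=> Lf Lg w hphi; have [nphi _] := hphi.
have mf := Lfun_measurable Lf; have mg := Lfun_measurable Lg.
have mphi := nice_measurable nphi.
have hX_phi := htest_hX i hphi; have mhX : measurable_fun setT (hX i phi).
  by apply: nice_measurable; case: hX_phi.
have hpsi : htest (fun x => phi (hflow i (- r) x)) by exact: htest_hflow.
have flowK a x : hflow i (- a) (hflow i a x) = x by rewrite hflow_add addNr hflow0.
have flowNK a x : hflow i a (hflow i (- a) x) = x by rewrite hflow_add subrr hflow0.
have msub : measurable_fun setT (fun u : measurableTypeR R => (u - r : measurableTypeR R)).
  exact: measurable_funB.
have mrsub : measurable_fun setT (fun u : measurableTypeR R => (r - u : measurableTypeR R)).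
  exact: measurable_funB.
have mI1 : measurable_fun setT (fun ux : measurableTypeR R * H => I ux.1).
  exact: (measurableT_comp mI measurable_fst).
pose Theta (ux : measurableTypeR R * H) := I ux.1 * (f ux.2 * hX i phi (hflow i (ux.1 - r) ux.2)).
pose Psi (ux : measurableTypeR R * H) := I ux.1 * (g (hflow i (r - ux.1) ux.2) * phi ux.2).
have mTheta : measurable_fun setT Theta.
  apply: measurable_funM => //; apply: measurable_funM; first exact: measurableT_comp.
  exact: (mflow msub mhX).
have mPsi : measurable_fun setT Psi.
  apply: measurable_funM => //; apply: measurable_funM; first exact: (mflow mrsub mg).
  exact: measurableT_comp.
have I0 u : 0 <= I u by rewrite /I indicE.
have pull u (F : H -> R) : measurable_fun setT F ->
    (\int[mu]_x `|(I u * F x)%:E| = (I u)%:E * \int[mu]_x `|(F x)%:E|)%E.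
  move=> mF; rewrite -ge0_integralZl_EFin//.
    by apply: eq_integral => x _; rewrite EFinM abseM gee0_abs// lee_fin.
  by apply: measurableT_comp => //; exact/measurable_EFinP.
have swap u : (\int[mu]_x (g (hflow i (r - u) x) * phi x)%:E
    = \int[mu]_x (g x * phi (hflow i (u - r) x))%:E)%E.
  have mF : measurable_fun setT (fun x => (g x * phi (hflow i (u - r) x))%:E).
    apply/measurable_EFinP; apply: measurable_funM => //.
    exact: (measurableT_comp mphi (measurable_hflow i (u - r))).
  rewrite -(integral_preserving (hflow_preserving i (r - u)) mF).
  by apply: eq_integral => x _; rewrite hflow_add addrA subrK subrr hflow0.
have iTheta : (leb \x muS)%E.-integrable setT (EFin \o Theta).
  apply: (integrable_flow_htest Lf hX_phi mTheta) => u.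
  apply: pull; apply: measurable_funM => //.
  exact: (measurableT_comp mhX (measurable_hflow i (u - r))).
have iPsi : (leb \x muS)%E.-integrable setT (EFin \o Psi).
  apply: (integrable_flow_htest Lg hphi mPsi) => u.
  rewrite pull; last first.
    apply: measurable_funM => //.
    exact: (measurableT_comp mg (measurable_hflow i (r - u))).
  congr (_ * _)%E.
  have mF : measurable_fun setT (fun x => `|(g x * phi (hflow i (u - r) x))%:E|%E).
    apply: measurableT_comp => //.
    apply/measurable_EFinP; apply: measurable_funM => //.
    exact: (measurableT_comp mphi (measurable_hflow i (u - r))).
  rewrite -(integral_preserving (hflow_preserving i (r - u)) mF).
  by apply: eq_integral => x _; rewrite hflow_add addrA subrK subrr hflow0.
have step1 : (\int[mu]_x (f (hflow i r x) * phi x)%:E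
    = \int[mu]_x (f x * phi (hflow i (- r) x))%:E)%E.
  have mF : measurable_fun setT (fun x => (f x * phi (hflow i (- r) x))%:E).
    apply/measurable_EFinP; apply: measurable_funM => //.
    exact: (measurableT_comp mphi (measurable_hflow i (- r))).
  rewrite -(integral_preserving (hflow_preserving i r) mF).
  by apply: eq_integral => x _; rewrite flowK.
have step2 x : (\int[leb]_u (Theta (u, x))%:E
    = (f x * phi x)%:E - (f x * phi (hflow i (- r) x))%:E)%E.
  have FTC := @hflow_FTC R n i phi (hflow i (- r) x) r r0 nphi.
  rewrite flowNK in FTC.
  rewrite -EFinB -mulrBr EFinM EFinB -FTC -integralZl//; last first.
    apply: continuous_compact_integrable; first exact: segment_compact.
    by apply: continuous_subspaceT; exact/nice_hflow_continuous/nice_hX.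
  rewrite [RHS]integral_mkcond; apply: eq_integral => u _.
  rewrite patchE /Theta /I indicE/=; case: (_ \in _); last by rewrite mul0r.
  by rewrite mul1r hflow_add EFinM.
have step3 : (\int[mu]_x (f x * phi (hflow i (- r) x))%:E - \int[mu]_x (f x * phi x)%:E
    = - \int[mu]_x \int[leb]_u (Theta (u, x))%:E)%E.
  under [in RHS]eq_integral do rewrite step2.
  rewrite (integralB_EFin measurableT (htest_integrable p1' Lf hphi)
    (htest_integrable p1' Lf hpsi)).
  rewrite fin_num_oppeB 1?addeC//.
  exact: (integrable_fin_num measurableT (htest_integrable p1' Lf hpsi)).
have step4 u : (\int[mu]_x (Theta (u, x))%:E = - \int[mu]_x (Psi (u, x))%:E)%E.
  rewrite /Theta /Psi /= /I indicE; case: (_ \in _); last first.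
    by under eq_integral do rewrite mul0r; under [in RHS]eq_integral do rewrite mul0r;
      rewrite integral0 oppe0.
  under eq_integral do rewrite mul1r; under [in RHS]eq_integral do rewrite mul1r.
  rewrite swap -(w (fun x => phi (hflow i (u - r) x))); last exact: htest_hflow.
  by apply: eq_integral => x _; rewrite hX_hflow.
rewrite step1 step3 -(Fubini (m1 := leb) (m2 := muS) iTheta).
have iPsi1 : leb.-integrable setT (fun u => \int[mu]_x (Psi (u, x))%:E)%E.
  exact: (integrable_fubini_F (m1 := leb) (m2 := muS) iPsi).
have -> : (\int[leb]_u \int[muS]_x (EFin \o Theta) (u, x)
   = - \int[leb]_u \int[mu]_x (Psi (u, x))%:E)%E.
  rewrite -integralN; last exact: integrable_add_def.
  by apply: eq_integral => u _; exact: step4.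
rewrite oppeK (Fubini (m1 := leb) (m2 := muS) iPsi).
apply: ae_eq_integral => //.
- exact: measurable_fubini_G iPsi.
- apply/measurable_EFinP; apply: measurable_funM => //.
  apply: measurable_interval_integral; exact: (mflow mrsub mg).
have := ae_integrable2 iPsi; apply: filterS => x iPx _ /=.
have [px|px] := eqVneq (phi x) 0.
  rewrite px mulr0 (eq_integral (cst 0%E)) ?integral0// => u _.
  by rewrite /Psi/= px !mulr0.
have iG : leb.-integrable setT (fun u => (I u * g (hflow i (r - u) x))%:E).
  have := integrableZl measurableT (phi x)^-1 iPx; apply: eq_integrable => // u _.
  by rewrite /Psi /= -EFinM; congr EFin; field.
rewrite /interval_integral /Rintegral EFinM fineK; last exact: integrable_fin_num.
rewrite muleC -integralZl//; apply: eq_integral => u _.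
by rewrite /Psi/= -EFinM; congr EFin; rewrite /I; ring.
Qed.

Lemma horizontal_estimate f g : f \in Lfun mu p%:E -> g \in Lfun mu p%:E ->
  htest_weak i f g ->
  Lp_norm mu p (fun x => f (hflow i r x) - f x) <= r * Lp_norm mu p g.
Proof.
move=> Lf Lg w; have mg := Lfun_measurable Lg.
have mrsub : measurable_fun setT (fun u : measurableTypeR R => (r - u : measurableTypeR R)).
  exact: measurable_funB.
pose G (ux : measurableTypeR R * H) := g (hflow i (r - ux.1) ux.2).
have mG : measurable_fun setT G by exact: (mflow mrsub mg).
have GN u : (\int[muS]_x (`|G (u, x)| `^ p)%:E <= (Lp_norm mu p g `^ p)%:E)%E.
  have [L e] := Lp_preserving (hflow_preserving i (r - u)) p1' Lg.
  by rewrite -e (integral_powR_norm p1' L).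
have [Lk kN] := interval_integral_Lp p1 r0 mG (Lp_norm_ge0 mu p g) GN.
set k := interval_integral r G in Lk kN.
have [Lfr _] := Lp_preserving (hflow_preserving i r) p1' Lf.
set fr := (fun x => f (hflow i r x)) in Lfr.
have Ld : fr - f \in Lfun mu p%:E by rewrite addrC -scaleN1r; exact: Lfun_lin.
have Lw : fr - f - k \in Lfun mu p%:E by rewrite addrC -scaleN1r; exact: Lfun_lin.
have w0 : Lp_norm mu p (fr - f - k) = 0.
  apply: Lp_norm_eq0_htest => // phi hphi.
  rewrite /Rintegral.
  have i1 := htest_integrable p1' Lfr hphi.
  have i2 := htest_integrable p1' Lf hphi.
  have i3 := htest_integrable p1' Lk hphi.
  have e : (\int[mu]_x ((fr - f - k) x * phi x)%:E =
    \int[mu]_x (fr x * phi x)%:E - \int[mu]_x (f x * phi x)%:E - \int[mu]_x (k x * phi x)%:E)%E.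
    rewrite -(integralB measurableT i1 i2) -(integralB measurableT _ i3).
      by apply: eq_integral => x _; rewrite /= -!EFinB !fctE; congr EFin; ring.
    exact: integrableB.
  rewrite e (htest_weak_integral Lf Lg w hphi) subee//.
  exact: (integrable_fin_num measurableT i3).
have -> : (fun x => f (hflow i r x) - f x) = (fr - f - k) + k.
  by apply/funext => x; rewrite !fctE subrK.
by apply: le_trans (Lp_normD p1' Lw Lk) _; rewrite w0 add0r.
Qed.

End horizontal.

(** * Vertical differences and the integral over all scales *)

Section dyadic_integral.
Context {R : realType}.
Local Notation leb := (@lebesgue_measure R).
Variables (e : R -> R) (Q : R).
Hypothesis e0 : forall t, 0 <= e t.
Let H (t : R) := e t ^+ 2 * t `^ (-2).
Hypothesis mH : measurable_fun setT (H : measurableTypeR R -> R).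

Let H0 t : 0 <= H t.
Proof. by rewrite mulr_ge0 ?powR_ge0 ?sqr_ge0. Qed.

Let mHE D : measurable_fun D (fun t : measurableTypeR R => (H t)%:E).
Proof. by apply/measurable_EFinP; exact: measurable_funTS. Qed.

(** On this piece the integrand is at most [m^2 / s^2], and its length is [s]. *)
Lemma integral_dyadic_piece (s m : R) : 0 < s ->
  (forall t, 0 < t <= 2 * s -> e t <= m) ->
  (\int[leb]_(t in `[s, (2 * s)%R[) (H t)%:E <= (m ^+ 2 / s)%:E)%E.
Proof.
move=> s0 em.
have m0 : 0 <= m by apply: le_trans (e0 s) (em s _); rewrite s0/=; lra.
have ss : s < 2 * s by lra.
have L : @lebesgue_measure R `[s, (2 * s)%R[%classic = s%:E.
  by rewrite lebesgue_measure_itv/= lte_fin ss -EFinB; congr EFin; lra.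
apply: (@le_trans _ _ (\int[leb]_(t in `[s, (2 * s)%R[) (m ^+ 2 / s ^+ 2)%:E)%E).
  apply: ge0_le_integral => //.
  - by move=> t _; rewrite lee_fin.
  move=> t /=; rewrite in_itv/= => /andP[st t2]; have t0 := lt_le_trans s0 st.
  rewrite lee_fin /H powR_invn ?(ltW t0)//; apply: ler_pM; rewrite ?sqr_ge0//.
  - by rewrite invr_ge0 sqr_ge0.
  - by rewrite ler_sqr ?nnegrE// em// t0 ltW.
  - by rewrite lef_pV2 ?posrE ?exprn_gt0// ler_sqr ?nnegrE// ltW.
rewrite integral_cst// [X in (_ * X)%E]L -EFinM lee_fin.
by rewrite le_eqVlt; apply/orP; left; apply/eqP; field; exact: lt0r_neq0.
Qed.

Lemma integral_dyadic (s : R) (M : R^nat) k : 0 < s ->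
  (forall m t, 0 < t <= 2 ^+ m * s -> e t <= M m) ->
  (\int[leb]_(t in `[s, (2 ^+ k * s)%R[) (H t)%:E
    <= (2 * \sum_(m < k) M m.+1 ^+ 2 / (2 ^+ m.+1 * s))%:E)%E.
Proof.
move=> s0 eM; elim: k => [|k IH].
  by rewrite expr0 mul1r set_itvco0 integral_set0 big_ord0 mulr0.
have sk : 0 < 2 ^+ k * s by exact: geometric_scale_gt0.
rewrite (_ : `[s, _[%classic =
  `[s, (2 ^+ k * s)%R[%classic `|` `[(2 ^+ k * s)%R, (2 * (2 ^+ k * s))%R[%classic); last first.
  rewrite -itv_bndbnd_setU ?bnd_simp//.
  - by rewrite exprS mulrA.
  - by rewrite ler_peMl ?(ltW s0)// exprn_ege1// ler1n.
  - by lra.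
rewrite ge0_integral_setU//.
- rewrite big_ord_recr/= mulrDr EFinD; apply: leeD => //.
  apply: le_trans (integral_dyadic_piece sk _) _.
    by move=> t; rewrite mulrA -exprS; exact: eM.
  rewrite lee_fin [2 ^+ k.+1]exprS le_eqVlt; apply/orP; left; apply/eqP; field.
  by rewrite !lt0r_neq0// exprn_gt0.
- by move=> t _; rewrite lee_fin.
- apply/disj_setPS => t [] /=; rewrite !in_itv/= => /andP[_ t1] /andP[t2 _].
  by move: (lt_le_trans t1 t2); rewrite ltxx.
Qed.

Lemma integral_from_dyadic_bounds :
  (forall s, 0 < s -> exists M : R^nat,
    (forall m t, 0 < t <= 2 ^+ m * s -> e t <= M m) /\
    (forall m, \sum_(i < m) M i ^+ 2 / (2 ^+ i * s) <= Q)) ->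
  (\int[leb]_(t in `]0%R, +oo[) (H t)%:E <= (2 * Q)%:E)%E.
Proof.
move=> hM.
pose F (k : nat) : set R := `[2 ^- k, 2 ^+ k[%classic.
have bound k : (\int[leb]_(t in F k) (H t)%:E <= (2 * Q)%:E)%E.
  have s0 : 0 < 2 ^- k :> R by rewrite invr_gt0 exprn_gt0.
  have [M [M1 M2]] := hM _ s0.
  have := integral_dyadic (k + k) s0 M1.
  rewrite exprD mulfK; last by rewrite expf_neq0.
  move=> /le_trans; apply; rewrite lee_fin ler_pM2l//.
  apply: le_trans (M2 (k + k).+1); rewrite [leRHS]big_ord_recl lerDr.
  by rewrite divr_ge0 ?sqr_ge0// mulr_ge0// ltW.
have FU : `]0%R, +oo[%classic = \bigcup_k F k.
  apply/seteqP; split => t /=.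
    rewrite in_itv/= andbT => t0.
    pose N := maxn (Num.truncn t).+1 (Num.truncn t^-1).+1.
    have lt_pow (x : R) m : 0 <= x -> ((Num.truncn x).+1 <= m)%N -> x < 2 ^+ m.
      move=> x0 xm; have /andP[_ /lt_le_trans] := truncn_itv x0; apply.
      rewrite -natrX ler_nat; apply: leq_trans (ltnW (ltn_expl _ _)) => //.
    exists N => //; rewrite /F/= in_itv/= lt_pow ?leq_maxl ?(ltW t0)// andbT.
    rewrite -[t in leRHS]invrK lef_pV2 ?posrE ?invr_gt0 ?exprn_gt0//.
    by apply/ltW/lt_pow; rewrite ?leq_maxr ?invr_ge0 ?(ltW t0).
  move=> [k _]; rewrite /F/= !in_itv/= andbT => /andP[/(lt_le_trans _) h _].
  by apply: h; rewrite invr_gt0 exprn_gt0.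
rewrite FU.
have ndF : nondecreasing_seq F.
  move=> a b ab; apply/subsetPset => t; rewrite /F/= !in_itv/= => /andP[ta tb].
  have pab : 2 ^+ a <= 2 ^+ b :> R by rewrite ler_weXn2l// ler1n.
  by rewrite (lt_le_trans tb)// andbT (le_trans _ ta)// lef_pV2 ?posrE ?exprn_gt0.
have mF k : measurable (F k : set (measurableTypeR R)) by exact: measurable_itv.
have c1 := @ge0_nondecreasing_set_cvg_integral _ (measurableTypeR R) R F (fun t => (H t)%:E)
  leb ndF mF (fun i => @mHE (F i)) (fun i x _ => H0 x).
by apply: cvge_to_le c1 _; exact: nearW.
Qed.

End dyadic_integral.

Section vertical.
Context {R : realType} (n : nat) (p : R).
Hypothesis hp : 1 < p <= 2.
Local Notation H := ('rV[R]_(n + n) * measurableTypeR R)%type.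
Local Notation mu := (lebesgue_heis R n).
Implicit Types (f g h : H -> R).
Local Notation N := (Lp_norm mu p).

Let p1 : 1 < p. Proof. by have /andP[] := hp. Qed.
Let p1' : 1 <= p. Proof. exact: ltW. Qed.

Let Lfun_sub f g : f \in Lfun mu p%:E -> g \in Lfun mu p%:E -> f - g \in Lfun mu p%:E.
Proof. by move=> Lf Lg; rewrite addrC -scaleN1r; exact: Lfun_lin. Qed.

Let Lfun_add f g : f \in Lfun mu p%:E -> g \in Lfun mu p%:E -> f + g \in Lfun mu p%:E.
Proof. by move=> Lf Lg; rewrite -[f]scale1r; exact: Lfun_lin. Qed.

Let N_sub f g : f \in Lfun mu p%:E -> g \in Lfun mu p%:E -> N (f - g) = N (g - f).
Proof.
by move=> Lf Lg; rewrite -opprB -scaleN1r Lp_normZ ?normrN1 ?mul1r//; exact: Lfun_sub.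
Qed.

(** Negative times reduce to positive ones by invariance of the norm. *)
Lemma horizontal_estimate_abs i r f g : f \in Lfun mu p%:E -> g \in Lfun mu p%:E ->
  htest_weak i f g ->
  N (fun x => f (hflow i r x) - f x) <= `|r| * N g.
Proof.
move=> Lf Lg w; have [r0|r0|->] := ltgtP r 0.
- have [Lfr _] := Lp_preserving (hflow_preserving i r) p1' Lf.
  have [Lfr' _] := Lp_preserving (hflow_preserving i (- r)) p1' Lf.
  rewrite ltr0_norm// -/((fun x => f (hflow i r x)) - f) N_sub//.
  have [_ <-] := Lp_preserving (hflow_preserving i (- r)) p1' (Lfun_sub Lf Lfr).
  rewrite (_ : (fun x => _) = (fun x => f (hflow i (- r) x) - f x)).
    by apply: horizontal_estimate => //; rewrite oppr_gt0.
  by apply/funext => x; rewrite !fctE hflow_add subrr hflow0.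
- by rewrite gtr0_norm//; exact: horizontal_estimate.
- rewrite normr0 mul0r (_ : (fun x => _) = 0 *: f).
    by rewrite Lp_normZ// normr0 mul0r.
  by apply/funext => x; rewrite hflow0 subrr scale0r.
Qed.

(** The four horizontal moves of the commutator, each estimated at the point
where it starts. *)
Lemma vertical_sqrt_estimate (j : 'I_n) s f g h : 0 < s ->
  f \in Lfun mu p%:E -> g \in Lfun mu p%:E -> h \in Lfun mu p%:E ->
  htest_weak (lshift n j) f g -> htest_weak (rshift n j) f h ->
  N (fun x => f (vshift s x) - f x) <= 2 * Num.sqrt s * (N g + N h).
Proof.
move=> s0 Lf Lg Lh wg wh; set r := Num.sqrt s.
have r0 : 0 <= r by exact: sqrtr_ge0.
pose a := hflow (lshift n j) r; pose b := hflow (rshift n j) r.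
pose a' := hflow (lshift n j) (- r); pose b' := hflow (rshift n j) (- r).
have flow_pres i t : measure_preserving mu (@hflow R n i t) by exact: hflow_preserving.
have L i t : (fun x => f (hflow i t x) - f x) \in Lfun mu p%:E.
  by apply: (Lfun_sub _ Lf); exact: (Lp_preserving (flow_pres i t) p1' Lf).1.
have pull i t (q : H -> H) : measure_preserving mu q ->
    (fun x => f (hflow i t (q x)) - f (q x)) \in Lfun mu p%:E /\
    N (fun x => f (hflow i t (q x)) - f (q x)) = N (fun x => f (hflow i t x) - f x).
  by move=> qP; exact: (Lp_preserving qP p1' (L i t)).
have [L1 e1] := pull (rshift n j) (- r) _ (measure_preserving_comp
  (flow_pres (lshift n j) (- r)) (measure_preserving_comp (flow_pres (rshift n j) r) (flow_pres (lshift n j) r))).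
have [L2 e2] := pull (lshift n j) (- r) _ (measure_preserving_comp (flow_pres (rshift n j) r) (flow_pres (lshift n j) r)).
have [L3 e3] := pull (rshift n j) r _ (flow_pres (lshift n j) r).
have L4 := L (lshift n j) r.
set d1 := (fun x => _) in L1 e1; set d2 := (fun x => _) in L2 e2.
set d3 := (fun x => _) in L3 e3; set d4 := (fun x => _) in L4.
have -> : (fun x => f (vshift s x) - f x) = d1 + (d2 + (d3 + d4)).
  apply/funext => x; rewrite -(sqr_sqrtr (ltW s0)) -(hflow_commutator j (Num.sqrt s) x).
  by rewrite !fctE /d1 /d2 /d3 /d4 /=; ring.
have b1 := horizontal_estimate_abs (- r) Lf Lh wh.
have b2 := horizontal_estimate_abs (- r) Lf Lg wg.
have b3 := horizontal_estimate_abs r Lf Lh wh.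
have b4 := horizontal_estimate_abs r Lf Lg wg.
rewrite -e1 normrN ger0_norm// in b1; rewrite -e2 normrN ger0_norm// in b2.
rewrite -e3 ger0_norm// in b3; rewrite ger0_norm// -/d4 in b4.
have t1 := Lp_normD p1' L1 (Lfun_add L2 (Lfun_add L3 L4)).
have t2 := Lp_normD p1' L2 (Lfun_add L3 L4).
have t3 := Lp_normD p1' L3 L4.
lra.
Qed.

Let c : R := ((2 + 16 / (p - 1) ^+ 2) ^+ 2)^-1.
Let c0 : 0 < c.
Proof.
rewrite invr_gt0 exprn_gt0// addr_gt0// divr_gt0// exprn_gt0// subr_gt0//.
Qed.

Definition vertical_constant : R := 2 ^+ 2 * (4 + 1728 / c).

Lemma vertical_constant_gt0 : 0 < vertical_constant.
Proof.
apply: mulr_gt0; first by rewrite exprn_gt0.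
apply: addr_gt0; first by rewrite ltr0n.
by apply: divr_gt0; [rewrite ltr0n|exact: c0].
Qed.

Lemma vertical_dyadic_bounds (j : 'I_n) f g h sigma : 0 < sigma ->
  f \in Lfun mu p%:E -> g \in Lfun mu p%:E -> h \in Lfun mu p%:E ->
  htest_weak (lshift n j) f g -> htest_weak (rshift n j) f h ->
  exists M : R^nat,
    (forall m t, 0 < t <= 2 ^+ m * sigma ->
      N (fun x => f (vshift t x) - f x) <= M m) /\
    (forall m, \sum_(i < m) M i ^+ 2 / (2 ^+ i * sigma)
      <= vertical_constant * (N g + N h) ^+ 2).
Proof.
move=> sigma0 Lf Lg Lh wg wh.
pose W f g h := [/\ f \in Lfun mu p%:E, g \in Lfun mu p%:E, h \in Lfun mu p%:E,
  htest_weak (lshift n j) f g & htest_weak (rshift n j) f h].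
have shiftL s u : u \in Lfun mu p%:E -> (fun x => u (vshift s x)) \in Lfun mu p%:E.
  by move=> Lu; have [] := Lp_preserving (@vshift_preserving R n s) p1' Lu.
apply: (@dyadic_vertical_bound R H (@vshift R n) (@vshift_add R n)
  (fun f => f \in Lfun mu p%:E) _ _ N _ _ _ _ c 2 _ _ _ W) => //.
- by move=> a u v Lu Lv; exact: Lfun_lin.
- by move=> u; exact: Lp_norm_ge0.
- by move=> u v Lu Lv; exact: Lp_normD.
- by move=> a u Lu; exact: Lp_normZ.
- by move=> s u Lu; have [] := Lp_preserving (@vshift_preserving R n s) p1' Lu.
- by move=> u v Lu Lv uv; exact: Lp_uniform_convexity.
- by move=> u v w [].
- move=> a u v w u' v' w' [? ? ? ? ?] [? ? ? ? ?].
  by split; [exact: Lfun_lin..|exact: (htest_weak_lin p1)|exact: (htest_weak_lin p1)].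
- move=> s u v w [? ? ? ? ?].
  by split; [exact: shiftL..|exact: (htest_weak_vshift (p := p))|exact: (htest_weak_vshift (p := p))].
- by move=> s u v w s0 [? ? ? ? ?]; exact: (vertical_sqrt_estimate (j := j)).
Qed.

End vertical.

Section main.
Context {R : realType} (n : nat) (p : R).
Hypothesis hp : 1 < p <= 2.
Local Notation H := ('rV[R]_(n + n) * measurableTypeR R)%type.
Local Notation mu := (lebesgue_heis R n).
Local Notation N := (Lp_norm mu p).
Let p1 : 1 < p. Proof. by have /andP[] := hp. Qed.
Let p1' : 1 <= p. Proof. exact: ltW. Qed.
Let p0 : 0 < p. Proof. exact: lt_trans p1. Qed.

Lemma hmul_vertical t (x : heis R n) : hmul x (0, t) = vshift t x.
Proof.
rewrite /hmul /vshift addr0 big1 ?mulr0 ?addr0// => j _.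
by rewrite !mxE !mulr0 subr0.
Qed.

Variable f : H -> R.
Hypothesis Lf : f \in Lfun mu p%:E.

Let dif t (x : H) : R := f (vshift t x) - f x.

Let Ldif t : dif t \in Lfun mu p%:E.
Proof.
rewrite (_ : dif t = -1 *: f + (fun x => f (vshift t x))); last first.
  by apply/funext => x; rewrite /dif scaleN1r addrC.
apply: Lfun_lin => //.
by have [] := Lp_preserving (@vshift_preserving R n t) p1' Lf.
Qed.

(** Tonelli gives measurability of the integral of [|f (x (0, t)) - f x|^p] in [t]. *)
Lemma measurable_vertical_norm :
  measurable_fun setT (fun t : measurableTypeR R => N (dif t)).
Proof.
pose J (t : R) := (\int[mu]_x (`|dif t x| `^ p)%:E)%E.
have E t : N (dif t) = (fine (J t)) `^ p^-1.
  by rewrite /J integral_powR_norm//= -powRrM mulfV ?gt_eqF// powRr1// Lp_norm_ge0.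
have mJ : measurable_fun setT (J : measurableTypeR R -> \bar R).
  pose F (tx : measurableTypeR R * H) := (`|f (vshift tx.1 tx.2) - f tx.2| `^ p)%:E.
  apply: (measurable_fun_fubini_tonelli_F (m2 := lebesgue_heis_sf n) F).
    have mf := Lfun_measurable Lf.
    apply/measurable_EFinP.
    apply: (@measurable_powR_norm _ _ _ p (fun tx => f (vshift tx.1 tx.2) - f tx.2)).
    apply: measurable_funB; last exact: measurableT_comp.
    exact: (measurableT_comp mf (@measurable_vshift2 R n)).
  by move=> tx; rewrite lee_fin powR_ge0.
rewrite (_ : (fun t => _) = (@powR R ^~ p^-1) \o (fine \o J)); last exact/funext.
apply: (measurableT_comp (measurable_powR p^-1)).
exact: measurableT_comp.
Qed.

Lemma vertical_integrandE t : 0 < t ->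
  ((\int[mu]_x ((`|f x - f (hmul x (0, t))| / Num.sqrt t) `^ p)%R%:E)
     `^ (2 / p) * (t^-1)%R%:E = (N (dif t) ^+ 2 * t `^ (-2))%:E)%E.
Proof.
move=> t0; have st0 : 0 < Num.sqrt t by rewrite sqrtr_gt0.
have Lu : (Num.sqrt t)^-1 *: dif t \in Lfun mu p%:E.
  have L0 := Lfun_lin p1' (-1) (Ldif t) (Ldif t); rewrite scaleN1r addNr in L0.
  by rewrite -[_ *: _]addr0; exact: Lfun_lin.
rewrite (eq_integral (fun x => (`|((Num.sqrt t)^-1 *: dif t) x| `^ p)%:E)); last first.
  move=> x _; rewrite hmul_vertical distrC scalrfctE /GRing.scale/= normrM.
  by rewrite [`|_^-1|]ger0_norm ?invr_ge0 ?(ltW st0)// mulrC.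
rewrite integral_powR_norm// poweR_EFin -powRrM mulrCA divff ?gt_eqF// mulr1.
rewrite Lp_normZ// ger0_norm ?invr_ge0 ?(ltW st0)// powR_mulrn; last first.
  by rewrite mulr_ge0 ?Lp_norm_ge0// invr_ge0 ltW.
rewrite -EFinM powR_invn ?(ltW t0)//; congr EFin.
rewrite exprMn exprVn sqr_sqrtr ?(ltW t0)//.
by field; exact: lt0r_neq0.
Qed.

Lemma vertical_integral_le (j : 'I_n) g h :
  g \in Lfun mu p%:E -> h \in Lfun mu p%:E ->
  htest_weak (lshift n j) f g -> htest_weak (rshift n j) f h ->
  (\int[@lebesgue_measure R]_(t in `]0%R, +oo[)
     ((\int[mu]_x ((`|f x - f (hmul x (0, t))| / Num.sqrt t) `^ p)%R%:E)
        `^ (2 / p) * (t^-1)%R%:E)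
   <= (2 * (vertical_constant p * (N g + N h) ^+ 2))%:E)%E.
Proof.
move=> Lg Lh wg wh.
rewrite (eq_integral (fun t : measurableTypeR R => (N (dif t) ^+ 2 * t `^ (-2))%:E)); last first.
  by move=> t; rewrite inE/= in_itv/= andbT => /vertical_integrandE.
apply: integral_from_dyadic_bounds.
- by move=> t; exact: Lp_norm_ge0.
- apply: measurable_funM; last exact: measurable_powR.
  by apply: measurable_funX; exact: measurable_vertical_norm.
by move=> s s0; exact: (vertical_dyadic_bounds hp s0 Lf Lg Lh wg wh).
Qed.

End main.

Lemma le_hnorm (R : realType) n (G : 'I_(n + n) -> heis R n -> R) i x :
  `|G i x| <= `|hnorm G x|.
Proof.
rewrite [leRHS]ger0_norm ?sqrtr_ge0// -sqrtr_sqr ler_wsqrtr// (bigD1 i)//= lerDl.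
by apply: sumr_ge0 => k _; exact: sqr_ge0.
Qed.

Lemma measurable_hnorm (R : realType) n (p : R) (G : 'I_(n + n) -> heis R n -> R) :
  (forall i, G i \in Lfun (lebesgue_heis R n) p%:E) ->
  measurable_fun [set: ('rV[R]_(n + n) * measurableTypeR R)%type] (hnorm G).
Proof.
move=> LG; apply: (@measurableT_comp _ _ _ _ _ _ (@Num.sqrt R)).
  by apply: continuous_measurable_fun; exact: sqrt_continuous.
by apply: measurable_sum => i; apply: measurable_funX; exact: Lfun_measurable (LG i).
Qed.

Theorem theorem7p1 (R : realType) (n : nat) (p : R)
    (n_gt0 : (0 < n)%N) (p_gt1 : 1 < p) (p_le2 : p <= 2) :
  exists C : R,
    forall (f : heis R n -> R) (G : 'I_(n + n) -> heis R n -> R),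
      f \in Lfun (lebesgue_heis R n) p%:E ->
      (forall i, G i \in Lfun (lebesgue_heis R n) p%:E) ->
      is_weak_hgrad f G ->
      ((\int[@lebesgue_measure R]_(t in `]0%R, +oo[)
          ((\int[lebesgue_heis R n]_x
              ((`|f x - f (hmul x (0, t))| / Num.sqrt t) `^ p)%R%:E)
             `^ (2 / p) * (t^-1)%R%:E))
         `^ 2^-1
       <= C%:E * 'N[lebesgue_heis R n]_p%:E[EFin \o hnorm G])%E.
Proof.
have hp : 1 < p <= 2 by rewrite p_gt1.
have p1 : 1 <= p by exact: ltW.
have := vertical_constant_gt0 hp.
have le_integral := @vertical_integral_le R n p hp.
move: (vertical_constant p) le_integral => K le_integral K0.
have C0 : 0 < Num.sqrt (8 * K) by rewrite sqrtr_gt0 mulr_gt0.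
exists (Num.sqrt (8 * K)) => f G Lf LG w.
pose mu := lebesgue_heis R n.
have [->|Gfin] := eqVneq ('N[mu]_p%:E[EFin \o hnorm G])%E +oo%E.
  by rewrite mulry gtr0_sg// mul1e leey.
have LN : hnorm G \in Lfun mu p%:E.
  rewrite inE; apply/andP; split; rewrite inE; first exact: measurable_hnorm LG.
  by rewrite /= /finite_norm ltey.
pose j := Ordinal n_gt0.
have weak i := is_weak_hX_htest p_gt1 Lf (LG i) (w i).
have GN i : Lp_norm mu p (G i) <= Lp_norm mu p (hnorm G).
  by have [] := @Lp_norm_homo _ ('rV[R]_(n + n) * measurableTypeR R)%type R mu p p1
    (G i) (hnorm G) (le_hnorm G i) (Lfun_measurable (LG i)) LN.
have := le_integral f Lf j _ _ (LG _) (LG _) (weak (lshift n j)) (weak (rshift n j)).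
set A := (\int[_]_(_ in _) _)%E => leA.
rewrite Lp_normE// -EFinM.
have A0 : (0 <= A)%E.
  apply: integral_ge0 => t; rewrite /= in_itv/= andbT => t0.
  by rewrite mule_ge0 ?poweR_ge0// lee_fin invr_ge0 ltW.
have leA2 : (A <= ((Num.sqrt (8 * K) * Lp_norm mu p (hnorm G)) ^+ 2)%:E)%E.
  apply: le_trans leA _; rewrite lee_fin exprMn sqr_sqrtr ?mulr_ge0 ?(ltW K0)//.
  rewrite (_ : 8 * K * _ = 2 * (K * (2 * Lp_norm mu p (hnorm G)) ^+ 2)); last by ring.
  rewrite ler_pM2l// ler_pM2l// ler_sqr ?nnegrE ?addr_ge0 ?mulr_ge0 ?Lp_norm_ge0//.
  by rewrite mulrDl mul1r lerD.
have h2 : 0 <= 2^-1 :> R by rewrite invr_ge0.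
have := gt0_ler_poweR h2 _ _ leA2.
rewrite !in_itv/= !leey !andbT A0 lee_fin sqr_ge0 => /(_ isT isT).
rewrite powR12_sqrt ?sqr_ge0// sqrtr_sqr ger0_norm//.
by rewrite mulr_ge0 ?Lp_norm_ge0// ltW.
Qed.
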